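(* Let $K,M\in\mathbb N$, $P>0$. Let $\mathcal X=\mathcal X_1\times\dots\times\mathcal X_K$ be a feature alphabet and $\mathcal Y=\{-1,1\}$. Let $g_k:\mathcal X_k\to\{-1,1\}$ be (measurable) base classifiers, $\alpha_k\ge0$ weights, and $g(x_1,\dots,x_K):=\sum_{k=1}^K\alpha_kg_k(x_k)$. Put $\bar\Delta(g)=2\sum_{k=1}^K\alpha_k$ and $\Delta(g)=2\max_{1\le k\le K}\alpha_k$. Let $\mathcal L:\mathcal X\times\mathcal Y\times\mathbb R\to[0,\infty)$ be a $\Lambda$-Lipschitz-continuous loss. Consider the $M$-use channel with fading and noise correlated as determined by matrices $A,B$, and let $A_i$ generate user-uncorrelated fading with $\|(A+A_i)(A-A_i)^T\|\le\eta$. Let $\varepsilon>0$, $\delta\in(0,1)$, and suppose $$M\ge\frac{\log4-\log\delta}{\varepsilon^2}\max\big(16F+D+4\varepsilon L,\ 256F+32\varepsilon L\big),$$ where $L=\big(\sqrt{\bar\Delta(g)}\|A\|+\sqrt{\Delta(g)/P}\,\|B\|\big)^2$, $F=L\big(\sqrt{\bar\Delta(g)/M}\,\|A\|_F+\sqrt{\Delta(g)/(PM)}\,\|B\|_F\big)^2$, $D=\big(4\sqrt{2M}\,\bar\Delta(g)\eta+4\frac{\Delta(g)}{\sqrt{PM}}\|AB^T\|_F\big)^2$. Then, given any $x^K=(x_1,\dots,x_K)\in\mathcal X$ drawn from an arbitrary distribution (in particular with arbitrarily correlated components), with $x_k$ available at transmitter $k$, and any $y\in\mathcal Y$, through $M$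 uses of the channel the receiver can obtain (by an admissible DFA scheme) an estimate $\bar g$ of $g(x^K)$ satisfying $$\mathbb P\big(|\mathcal L(x^K,y,\bar g)-\mathcal L(x^K,y,g(x^K))|\ge\Lambda\varepsilon\big)\le\delta .$$
   Context: $\|\cdot\|$ and $\|\cdot\|_F$ are the operator and Frobenius norms of matrices; $\log$ is the natural logarithm. The loss $\mathcal L$ is $\Lambda$-Lipschitz-continuous if for all $x\in\mathcal X$, $y\in\mathcal Y$ the map $\mathcal L(x,y,\cdot)$ is Lipschitz with constant at most $\Lambda$. Sub-Gaussian norm: for a real random variable $X$, $\tau(X):=\inf\{t>0:\forall\lambda\in\mathbb R,\ \mathbb E\exp(\lambda(X-\mathbb EX))\le\exp(\lambda^2t^2/2)\}$; $X$ is sub-Gaussian if $\tau(X)<\infty$. Channel: for $m=1,\dots,M$ the output is $Y(m)=\sum_{k=1}^KH_k(m)z_k(m)+N(m)$, with inputs $z_k(m)\in\mathbb C$, $|z_k(m)|^2\le P$. The complex random variables $H_k(m)=H_k^r(m)+iH_k^i(m)$ have sub-Gaussian real and imaginary parts with mean $0$ and variance $1$; $N(m)=N^r(m)+iN^i(m)$ has sub-Gaussian real and imaginary parts with mean $0$. Put $H:=(H(1),\dots,H(2M))^T\in\mathbb R^{2KM}$ with blocks $H(2m-1):=(H_1^r(m),\dots,H_K^r(m))$, $H(2m):=(H_1^i(m),\dots,H_K^i(m))$, and $N:=(N^r(1),N^i(1),\dots,N^r(M),N^i(M))^T\in\mathbb R^{2M}$. Fading and noise are ''correlated as determined by $A\in\mathbb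 R^{2KM\times(2KM+2M)}$ and $B\in\mathbb R^{2M\times(2KM+2M)}$'' if there is a random vector $R$ with $2KM+2M$ independent real entries, each of sub-Gaussian norm at most $1$, such that $H=AR$ and $N=BR$. User-uncorrelated: a matrix $A_i\in\mathbb R^{2KM\times(2KM+2M)}$, split vertically into $2M$ consecutive blocks $A_i^{(1)},\dots,A_i^{(2M)}\in\mathbb R^{K\times(2KM+2M)}$, generates user-uncorrelated fading if each block has at most one nonzero entry per column. Admissible DFA scheme with $M$ channel uses: encoders $E_k^M(x_k)=(E_k(m,x_k,U_k(m)))_{m=1}^M\in\mathbb C^M$, $k=1,\dots,K$, where the $U_k(m)$ are random variables, jointly independent of $(H,N)$ and of the data, the map $(x_k,t_1,\dots,t_M)\mapsto(E_k(m,x_k,t_m))_{m=1}^M$ is measurable, and $|E_k(m,x_k,U_k(m))|^2\le P$; together with a measurable decoder $D^M:\mathbb C^M\to\mathbb R$. The resulting estimate is $D^M(Y(1),\dots,Y(M))$ when $z_k(m)=E_k(m,x_k,U_k(m))$. The data $x^K$ is independent of $(H,N)$.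
   Formalization: The Lipschitz constant Λ is taken to be strictly positive; for Λ = 0 the event |L(x,y,ḡ) − L(x,y,g)| ≥ Λε is the whole space, so its probability is 1 > δ and the claim always fails. *)

(* Defs.v *)
From HB Require Import structures.
From mathcomp Require Import all_boot all_order all_algebra.
From mathcomp Require Import all_classical all_reals all_analysis.
From mathcomp Require Import complex.
From mathcomp Require Import zify.

Set Implicit Arguments.
Unset Strict Implicit.
Unset Printing Implicit Defensive.

Import Order.TTheory GRing.Theory Num.Theory.
Import numFieldNormedType.Exports.

Local Open Scope classical_set_scope.
Local Open Scope ring_scope.
Local Open Scope complex_scope.

(* The Borel sigma-algebra of C, transported from R * R. *)
Section complex_measurable.
Context (R : realType).

Definition complex_pair (z : R[i]) : R * R := (complex.Re z, complex.Im z).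

HB.instance Definition _ := isPointed.Build R[i] 0.

HB.instance Definition _ := Measurable.copy R[i]
  (g_sigma_algebra_preimageType complex_pair).

End complex_measurable.

Section matrix_norms.
Context (R : realType).

Definition fnorm m n (A : 'M[R]_(m, n)) : R :=
  Num.sqrt (\sum_i \sum_j A i j ^+ 2).

(* On column vectors [fnorm] is the Euclidean norm. *)
Definition opnorm m n (A : 'M[R]_(m, n)) : R :=
  sup [set fnorm (A *m v) | v in [set v : 'cV[R]_n | fnorm v <= 1]].

End matrix_norms.

Section sub_gaussian.
Context (R : realType) (d : measure_display) (T : measurableType d).
Context (Pr : probability T R).
Local Open Scope ereal_scope.

(* +oo if no t is admissible.  If X is not integrable then some exponential
   moment is infinite whatever the value of [fine 'E_Pr[X]], so no t is. *)
Definition sg_norm (X : T -> R) : \bar R :=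
  ereal_inf [set t%:E | t in [set t : R | (0 < t)%R /\
    forall l : R, 'E_Pr[(fun w => expR (l * (X w - fine 'E_Pr[X])))%R]
                  <= (expR (l ^+ 2 * t ^+ 2 / 2))%:E]].

Definition sub_gaussian (X : T -> R) : Prop := sg_norm X < +oo.

(* The product rule for subfamilies is the case E i = setT off the subfamily. *)
Definition independent_family n (S : 'I_n -> T -> R) : Prop :=
  forall E : 'I_n -> set R, (forall i, measurable (E i)) ->
    Pr (\bigcap_i (S i @^-1` E i)) = \big[*%E/1]_(i < n) Pr (S i @^-1` E i).

End sub_gaussian.

(* Coordinate i = (2m + c) K + k of H is the real (c = 0) or imaginary (c = 1)
   part of H_k(m), and coordinate 2m + c of N is that of N(m), all indices
   starting at 0. *)
Section stacking.
Context (K M : nat).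

Fact user_subproof (i : 'I_(2 * K * M)) : (i %% K < K)%N.
Proof. by case: i => i /= hi; rewrite ltn_mod; nia. Qed.

Fact use_subproof (i : 'I_(2 * K * M)) : ((i %/ K)./2 < M)%N.
Proof.
case: i => i /= hi; have K0 : (0 < K)%N by nia.
by rewrite -divn2 -divnMA ltn_divLR //; nia.
Qed.

Fact noise_use_subproof (i : 'I_(2 * M)) : (i./2 < M)%N.
Proof. by case: i => i /= hi; lia. Qed.

Definition user_of (i : 'I_(2 * K * M)) : 'I_K := Ordinal (user_subproof i).
Definition use_of (i : 'I_(2 * K * M)) : 'I_M := Ordinal (use_subproof i).
Definition noise_use_of (i : 'I_(2 * M)) : 'I_M :=
  Ordinal (noise_use_subproof i).

Context (R : realType).

Definition re_im (c : bool) (z : R[i]) : R :=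
  if c then complex.Im z else complex.Re z.

Definition fading_vec (h : 'I_K -> 'I_M -> R[i]) : 'cV[R]_(2 * K * M) :=
  \col_i re_im (odd (i %/ K)) (h (user_of i) (use_of i)).

Definition noise_vec (n : 'I_M -> R[i]) : 'cV[R]_(2 * M) :=
  \col_i re_im (odd i) (n (noise_use_of i)).

(* Rows i and i' lie in the same block of K consecutive rows
   iff i %/ K = i' %/ K. *)
Definition user_uncorrelated n (Ai : 'M[R]_(2 * K * M, n)) : Prop :=
  forall (i i' : 'I_(2 * K * M)) (j : 'I_n),
    (i %/ K = i' %/ K)%N -> Ai i j != 0 -> Ai i' j != 0 -> i = i'.

End stacking.

Record correlated_channel (R : realType) (K M : nat) (d : measure_display)
    (T : measurableType d) (Pr : probability T R)
    (A : 'M[R]_(2 * K * M, 2 * K * M + 2 * M))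
    (B : 'M[R]_(2 * M, 2 * K * M + 2 * M))
    (H : 'I_K -> 'I_M -> {RV Pr >-> R[i]}) (N : 'I_M -> {RV Pr >-> R[i]}) :
    Prop := {
  fading_sub_gaussian : forall k m c, sub_gaussian Pr (re_im c \o H k m);
  fading_mean : forall k m c, ('E_Pr[re_im c \o H k m] = 0)%E;
  fading_variance : forall k m c, ('V_Pr[re_im c \o H k m] = 1)%E;
  noise_sub_gaussian : forall m c, sub_gaussian Pr (re_im c \o N m);
  noise_mean : forall m c, ('E_Pr[re_im c \o N m] = 0)%E;
  correlated_by : exists S : 'I_(2 * K * M + 2 * M) -> {RV Pr >-> R},
    [/\ independent_family Pr (fun j => S j : T -> R),
        forall j, (sg_norm Pr (S j) <= 1)%E,
        forall w, fading_vec (fun k m => H k m w) = A *m \col_j S j w &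
        forall w, noise_vec (fun m => N m w) = B *m \col_j S j w]
}.

(* The random variables U_k(m) = [rnd k m] live on a probability space of their
   own, with values in an arbitrary measurable space, and need not be independent
   of each other.  Taking the product of [rnd_law] with the spaces carrying the
   data and (H, N) makes the three mutually independent. *)
Record dfa_scheme (R : realType) (K M : nat) (dX : 'I_K -> measure_display)
    (X : forall k, measurableType (dX k)) (power : R) := DfaScheme {
  rnd_disp : measure_display;
  rnd_space : measurableType rnd_disp;
  rnd_law : probability rnd_space R;
  rnd_val_disp : measure_display;
  rnd_val : measurableType rnd_val_disp;
  rnd : 'I_K -> 'I_M -> {RV rnd_law >-> rnd_val};
  encode : forall k, 'I_M -> X k -> rnd_val -> R[i];
  decode : M.-tuple R[i] -> R;
  measurable_encode : forall k, measurable_fun setT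
    (fun p : X k * M.-tuple rnd_val =>
       [tuple encode m p.1 (tnth p.2 m) | m < M]);
  measurable_decode : measurable_fun setT decode;
  power_constraint : forall k m (x : X k) w,
    `|encode m x (rnd k m w)| ^+ 2 <= power%:C
}.

Definition channel_output (R : realType) (K M : nat)
    (h z : 'I_K -> 'I_M -> R[i]) (n : 'I_M -> R[i]) : M.-tuple R[i] :=
  [tuple (\sum_k h k m * z k m) + n m | m < M].

Definition dfa_estimate (R : realType) (K M : nat) (dX : 'I_K -> measure_display)
    (X : forall k, measurableType (dX k)) (power : R)
    (S : dfa_scheme M X power) (h : 'I_K -> 'I_M -> R[i]) (n : 'I_M -> R[i])
    (x : forall k, X k) (u : rnd_space S) : R :=
  decode S (channel_output h (fun k m => encode m (x k) (rnd S k m u)) n).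

Definition labels (R : realType) : set R := [set -1; 1].

Definition ensemble (R : realType) (K : nat) (X : 'I_K -> Type) (alpha : 'I_K -> R)
    (g : forall k, X k -> R) (x : forall k, X k) : R :=
  \sum_k alpha k * g k (x k).

Definition total_spread (R : realType) (K : nat) (alpha : 'I_K -> R) : R :=
  2 * \sum_k alpha k.

(* The weights are nonnegative, so the default value 0 is harmless. *)
Definition max_spread (R : realType) (K : nat) (alpha : 'I_K -> R) : R :=
  2 * \big[Num.max/0]_k alpha k.

(* Main.v *)
Require Import Defs.
From HB Require Import structures.
From mathcomp Require Import all_boot all_order all_algebra.
From mathcomp Require Import all_classical all_reals all_analysis.
From mathcomp Require Import measurable_realfun complex.
From mathcomp Require Import ring lra zify.

Set Implicit Arguments.
Unset Strict Implicit.
Unset Printing Implicit Defensive.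

Import Order.TTheory GRing.Theory Num.Theory.
Import numFieldNormedType.Exports.

Local Open Scope classical_set_scope.
Local Open Scope ring_scope.

(** Every user sends its signal with random signs: at use m, user k sends
    a_k(x_k) e_k(m) e_0(m), where the e_k(m) and e_0(m) are independent uniform
    signs and a_k^2 = (P / Delta(g)) alpha_k (g_k + 1).  The randomness of a scheme
    need not be independent across users, so the sign e_0(m) may be shared.  As
    e_0(m)^2 = 1, the received energy is that of \sum_k a_k e_k H_k + e_0 N: the
    noise acts as one more randomly signed user.  Its expectation is an affine
    function of \sum_k alpha_k g_k, which the receiver inverts.

    Fading and noise are linear in independent centred sub-Gaussian sources X, so
    given the signs e the rescaled energy is a positive quadratic form |C_e X|^2.
    Its fluctuation is controlled by a Hanson-Wright bound on exponential moments.
    Its conditional mean given e is, up to a constant, the off-diagonal part of a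
    positive quadratic form in the signs, to which the same bound applies.  A
    Chernoff bound for the product measure concludes.

    For the Hanson-Wright bound, exp(x + y) <= (exp(2x) + exp(2y)) / 2 separates the
    diagonal from the off-diagonal part.  The latter is the average over subsets I
    of four times the part pairing I with its complement; integrating X over I
    first leaves E exp(c |C X'|^2), where X' is X restricted to the complement of I
    and c is quadratic in the original parameter.  Hence the maximum over I of
    E exp(theta |C X'|^2) is at most the mean of itself and the diagonal term, so
    it is at most the diagonal term. *)

(** * Resampling independent coordinates *)

Section independence.
Context (R : realType) (d : measure_display) (T : measurableType d).
Context (Pr : probability T R) (n : nat) (X : 'I_n -> T -> R).
Hypothesis mX : forall i, measurable_fun setT (X i).
Hypothesis indX : independent_family Pr X.
Local Open Scope ereal_scope.

Definition box (E : 'I_n -> set R) : set (n.-tuple R) :=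
  [set t | forall i, E i (tnth t i)].

(** A coordinate preimage is a box whose other sides are full, and a box is a finite intersection of
    such preimages. Boxes are preferred as generators because they are stable under intersection. *)
Lemma measurable_tuple_box :
  @measurable _ (n.-tuple R) =
  <<s [set box E | E in [set E : 'I_n -> set R | forall i, measurable (E i)]] >>.
Proof.
apply/seteqP; split.
- apply: smallest_sub; first exact: smallest_sigma_algebra.
  move=> A; rewrite -bigcup_seq => -[i _ [B mB <-]].
  apply: sub_sigma_algebra; exists (fun j => if j == i then B else setT).
    by move=> j /=; case: ifP.
  rewrite setTI; apply/seteqP; split=> t /=; first by move=> /(_ i); rewrite eqxx.
  by move=> Bt j; case: eqP => // ->.
- apply: smallest_sub; first exact: sigma_algebra_measurable.
  move=> _ [E mE <-].
  rewrite (_ : box E = \bigcap_(i in setT) ((@tnth n R)^~ i @^-1` E i)); last first.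
    by apply/seteqP; split=> t /= tE i; [move=> _|]; exact: tE.
  apply: fin_bigcap_measurable => // i _.
  by rewrite -[X in measurable X]setTI; exact: measurable_tnth.
Qed.

(** Boxes form a generating pi-system containing the whole space, and finite mass lets the constant
    sequence [setT] serve as the cover. *)
Lemma measure_tuple_unique (m1 m2 : {measure set (n.-tuple R) -> \bar R}) :
  m1 setT < +oo ->
  (forall E, (forall i, measurable (E i)) -> m1 (box E) = m2 (box E)) ->
  forall A, measurable A -> m1 A = m2 A.
Proof.
move=> m1oo m12 A mA.
apply: (measure_unique
  [set box E | E in [set E : 'I_n -> set R | forall i, measurable (E i)]]
  (fun _ => setT)) => //.
- exact: measurable_tuple_box.
- move=> _ _ [E mE <-] [F mF <-]; exists (fun i => E i `&` F i).
    by move=> i; exact: measurableI.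
  apply/seteqP; split=> t /=.
    by move=> tEF; split=> i; have [] := tEF i.
  by move=> -[tE tF] i; split; [exact: tE|exact: tF].
- by move=> _; exists (fun _ => setT) => //; apply/seteqP; split.
- by rewrite bigcup_const //; exists 0%N.
- by move=> _ [E mE <-]; exact: m12.
Qed.

Definition mix (I : {set 'I_n}) (w' w : T) (i : 'I_n) : R :=
  if i \in I then X i w else X i w'.

Let Z I (w : T * T) : n.-tuple R := [tuple mix I w.1 w.2 i | i < n].

Let mZ I : measurable_fun setT (Z I).
Proof.
apply/measurable_fun_tnthP => i.
apply: (@eq_measurable_fun _ _ _ _ _ (fun w : T * T => mix I w.1 w.2 i)).
  by move=> w _; rewrite /= tnth_mktuple.
rewrite /mix; case: (i \in I).
  by apply: (measurableT_comp (mX i)).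
by apply: (measurableT_comp (mX i)).
Qed.

(** By independence the law of [X] is a product, so reading the coordinates in [I] from a second,
    independent outcome leaves it unchanged. The two laws are compared on boxes. *)
Lemma resample (I : {set 'I_n}) (h : ('I_n -> R) -> R) :
  measurable_fun setT (fun t : n.-tuple R => h (tnth t)) ->
  (forall x, 0 <= h x)%R ->
  \int[Pr]_w (h (X ^~ w))%:E = \int[Pr]_w' \int[Pr]_w (h (mix I w' w))%:E.
Proof.
move=> mh h0.
pose Y (w : T) : n.-tuple R := [tuple X i w | i < n].
have mY : measurable_fun setT Y.
  apply/measurable_fun_tnthP => i; apply: eq_measurable_fun (mX i) => w _.
  by rewrite /= tnth_mktuple.
pose f (t : n.-tuple R) := (h (tnth t))%:E.
have mf : measurable_fun setT f by exact/measurable_EFinP.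
have f0 t : 0 <= f t by rewrite lee_fin.
pose mY' := @isMeasurableFun.Build _ _ _ _ Y mY.
pose mZ' := @isMeasurableFun.Build _ _ _ _ (Z I) (mZ I).
pose Ym : {mfun T >-> n.-tuple R} := HB.pack Y mY'.
pose Zm : {mfun (T * T)%type >-> n.-tuple R} := HB.pack (Z I) mZ'.
transitivity (\int[distribution Pr Ym]_t f t).
  rewrite ge0_integral_pushforward// preimage_setT.
  apply: eq_integral => w _ /=; congr (h _)%:E.
  by apply/funext => i; rewrite tnth_mktuple.
transitivity (\int[distribution (Pr \x Pr) Zm]_t f t); last first.
  rewrite ge0_integral_pushforward// preimage_setT.
  rewrite (fubini_tonelli1 (f \o Z I))//=; last exact: measurableT_comp mf (mZ I).
  apply: eq_integral => w' _; apply: eq_integral => w _ /=; congr (h _)%:E.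
  by apply/funext => i; rewrite tnth_mktuple.
apply: eq_measure_integral => A mA _.
apply: (@measure_tuple_unique (distribution Pr Ym) (distribution (Pr \x Pr) Zm)) => //.
  exact: le_lt_trans (probability_le1 (distribution Pr Ym) measurableT) (ltry _).
move=> E mE; rewrite /distribution /pushforward /=.
have YE : Y @^-1` box E = \bigcap_(i in setT) (X i @^-1` E i).
  by apply/seteqP; split=> w /= wE i; [move=> _|]; have := wE i;
    rewrite tnth_mktuple//; apply.
(* [E1] and [E2] split a box into its conditions on [I] and off [I], padded with [setT].
   Independence turns both into products, and for each index one of the two factors is 1. *)
pose E1 i := if i \in I then E i else setT.
pose E2 i := if i \in I then setT else E i.
have mE1 i : measurable (E1 i) by rewrite /E1; case: ifP.
have mE2 i : measurable (E2 i) by rewrite /E2; case: ifP.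
have mcap (F : 'I_n -> set R) : (forall i, measurable (F i)) ->
    measurable (\bigcap_(i in setT) (X i @^-1` F i)).
  move=> mF; apply: fin_bigcap_measurable => // i _.
  by rewrite -[X in measurable X]setTI; exact: mX.
have ZE : Z I @^-1` box E = (\bigcap_(i in setT) (X i @^-1` E2 i)) `*`
                          (\bigcap_(i in setT) (X i @^-1` E1 i)).
  apply/seteqP; split=> [[w' w] /= wE|[w' w] /= [w1 w2] i].
    by split=> i _ /=; have := wE i; rewrite tnth_mktuple /mix /E1 /E2;
      case: ifP.
  have := w1 i Logic.I; have := w2 i Logic.I.
  by rewrite tnth_mktuple /mix /E1 /E2; case: ifP.
transitivity (Pr (\bigcap_(i in setT) (X i @^-1` E i))).
  by congr (Pr _); exact: YE.
transitivity ((Pr \x Pr) ((\bigcap_(i in setT) (X i @^-1` E2 i)) `*`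
                          (\bigcap_(i in setT) (X i @^-1` E1 i)))); last first.
  by congr ((Pr \x Pr) _); exact/esym/ZE.
rewrite product_measure1E; [|exact: mcap|exact: mcap].
transitivity ((\big[*%E/1]_(i < n) Pr (X i @^-1` E2 i)) *
              (\big[*%E/1]_(i < n) Pr (X i @^-1` E1 i))); last first.
  by congr (_ * _); exact/esym/indX.
rewrite indX// -big_split/=; apply: eq_bigr => i _.
by rewrite /E1 /E2; case: ifP => _; rewrite preimage_setT probability_setT ?mule1 ?mul1e.
Qed.

(** Working form of resampling: only a bound on the inner integral has to be supplied, for each
    frozen [w']. *)
Lemma resample_le (I : {set 'I_n}) (h : ('I_n -> R) -> R) (g : T -> R) :
  measurable_fun setT (fun t : n.-tuple R => h (tnth t)) ->
  (forall x, 0 <= h x)%R -> measurable_fun setT g ->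
  (forall w', \int[Pr]_w (h (mix I w' w))%:E <= (g w')%:E) ->
  \int[Pr]_w (h (X ^~ w))%:E <= \int[Pr]_w (g w)%:E.
Proof.
move=> mh h0 mg hg; rewrite (resample I mh h0); apply: ge0_le_integral => //.
- by move=> w' _; apply: integral_ge0 => w _; rewrite lee_fin.
- pose f p := (h (tnth (Z I p)))%:E.
  apply: (@eq_measurable_fun _ _ _ _ _ (fun w' => \int[Pr]_w f (w', w))).
    move=> w' _; apply: eq_integral => w _; congr (h _)%:E.
    by apply/funext => i; rewrite tnth_mktuple.
  apply: measurable_fun_fubini_tonelli_F.
    apply/measurable_EFinP; exact: (measurableT_comp mh (mZ I)).
  by move=> p; rewrite lee_fin.
- exact/measurable_EFinP.
Qed.

End independence.

(** * Sub-Gaussian variables *)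

(** From x/2 <= exp(x/2 - 1) and e >= 2 one gets x <= exp(x/2), which is then squared. *)
Lemma sqr_le_expR (R : realType) (x : R) : 0 <= x -> x ^+ 2 <= expR x.
Proof.
move=> x0; have e2 : 2 <= expR 1 :> R by have := expR_ge1Dx (1 : R); lra.
have h : x / 2 <= expR (x / 2 - 1) by have := expR_ge1Dx (x / 2 - 1); lra.
have h' : x <= expR (x / 2).
  rewrite (_ : x / 2 = x / 2 - 1 + 1); last by ring.
  rewrite expRD; apply: le_trans (_ : x / 2 * 2 <= _); first by rewrite divfK.
  by apply: ler_pM => //; rewrite divr_ge0.
rewrite (_ : expR x = expR (x / 2) ^+ 2); first by rewrite lerXn2r// nnegrE ?expR_ge0.
by rewrite expr2 -expRD -splitr.
Qed.

(** Both signs of x start from exp(x) <= 1 + x exp(x), that is (1 - x) exp(x) <= 1, and then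
    estimate the factor exp(x) on the right once more. *)
Lemma expR_le_quadratic (R : realType) (x : R) :
  expR x <= 1 + x + x ^+ 2 * expR `|x|.
Proof.
have e0 := expR_gt0 x.
have h : (1 - x) * expR x <= 1.
  by rewrite -ler_pdivlMr// div1r -expRN expR_ge1Dx.
case: (ger0P x) => x0; first nra.
have e1 : 1 <= expR (- x) by have := expR_ge1Dx (- x); lra.
have h2 := expR_ge1Dx x.
have h3 : x * expR (- x) <= x by nra.
have h4 : x * expR x <= x * (1 + x * expR (- x)) by nra.
nra.
Qed.

Lemma integral_probability_cst (R : realType) (d : measure_display)
    (T : measurableType d) (Pr : probability T R) (b : \bar R) :
  (\int[Pr]_w b = b)%E.
Proof.
transitivity (b * Pr setT)%E; first exact: integral_cst.
by rewrite probability_setT mule1.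
Qed.

Section sub_gaussian_moments.
Context (R : realType) (d : measure_display) (T : measurableType d).
Context (Pr : probability T R) (X : T -> R).
Hypothesis mX : measurable_fun setT X.
Hypothesis sgX : forall l : R,
  (\int[Pr]_w (expR (l * X w))%:E <= (expR (l ^+ 2 / 2))%:E)%E.

Lemma integrable_expRM (l : R) :
  Pr.-integrable setT (fun w => (expR (l * X w))%:E).
Proof.
apply/integrableP; split.
  by apply/measurable_EFinP/measurableT_comp => //; exact: measurable_funM.
under eq_integral do rewrite gee0_abs ?lee_fin ?expR_ge0//.
exact: le_lt_trans (sgX l) (ltry _).
Qed.

(** Moments are obtained by domination: the exponential moments at 1 and -1 are finite. *)
Lemma integrable_le_cosh (f : T -> R) (c : R) : measurable_fun setT f ->
  (forall w, `|f w| <= c * (expR (X w) + expR (- X w))) ->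
  Pr.-integrable setT (fun w => (f w)%:E).
Proof.
move=> mf fc.
have ig : Pr.-integrable setT (fun w => (c * (expR (X w) + expR (- X w)))%:E).
  have := integrableD measurableT (integrable_expRM 1) (integrable_expRM (-1)).
  move=> /(integrableZl measurableT c); apply: eq_integrable => // w _ /=.
  by rewrite mul1r mulN1r -EFinD -EFinM.
apply: (le_integrable measurableT _ _ ig); first exact/measurable_EFinP.
move=> w _; rewrite /= lee_fin; apply: le_trans (fc w) _.
exact: ler_norm.
Qed.

Lemma sg_integrable : Pr.-integrable setT (fun w => (X w)%:E).
Proof.
apply: (@integrable_le_cosh _ 1) => // w; rewrite mul1r ler_norml.
have := expR_ge1Dx (X w); have := expR_ge1Dx (- X w).
have := expR_gt0 (X w); have := expR_gt0 (- X w).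
by move=> *; apply/andP; split; lra.
Qed.

Lemma sg_sqr_integrable : Pr.-integrable setT (fun w => (X w ^+ 2)%:E).
Proof.
apply: (@integrable_le_cosh _ 2); first exact: measurable_funX.
move=> w; rewrite ger0_norm ?sqr_ge0//.
have /(expR_ge1Dxn 1) := normr_ge0 (X w); rewrite real_normK ?num_real//
  (_ : 2`!%:R = 2 :> R)// => h.
have : expR `|X w| <= expR (X w) + expR (- X w).
  by case: (ger0P (X w)) => _; rewrite ?lerDl ?lerDr expR_ge0.
by lra.
Qed.

(* exp(a x^2) is the Gaussian average of exp(sqrt(2a) z x) over z, which is
   linear in x in the exponent. *)
Lemma sg_expR_sqr_le (a : R) : 0 <= a < 2^-1 ->
  (\int[Pr]_w (expR (a * X w ^+ 2))%:E <= ((Num.sqrt (1 - 2 * a))^-1)%:E)%E.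
Proof.
move=> /andP[a0 a12].
have s2 : 0 < 1 - 2 * a by lra.
set s := (Num.sqrt (1 - 2 * a))^-1.
have s0 : 0 < s by rewrite invr_gt0 sqrtr_gt0.
have sE : s ^+ 2 = (1 - 2 * a)^-1 by rewrite exprVn sqr_sqrtr// ltW.
set b := Num.sqrt (2 * a).
have bE : b ^+ 2 = 2 * a by rewrite sqr_sqrtr// mulr_ge0.
(* Completing the square: tilting the standard normal density by exp(u z) moves its mean to u. *)
have pdfE (u z : R) : expR (u * z) * normal_pdf 0 1 z = expR (u ^+ 2 / 2) * normal_pdf u 1 z.
  rewrite !normal_pdfE ?oner_neq0// /normal_fun !(mulrCA (expR _)) -!expRD.
  congr (_ * expR _); rewrite expr1n; by field.
have mpdf : forall u v : R, measurable_fun setT (normal_pdf u v) by exact: measurable_normal_pdf.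
pose F (p : T * R) := (expR (b * p.2 * X p.1) * normal_pdf 0 1 p.2)%:E.
have mF : measurable_fun setT F.
  apply/measurable_EFinP/measurable_funM; last exact: measurableT_comp.
  apply: measurableT_comp => //; apply: measurable_funM; last exact: measurableT_comp.
  by apply: measurable_funM.
have F0 p : (0 <= F p)%E by rewrite lee_fin mulr_ge0 ?expR_ge0 ?normal_pdf_ge0//.
have -> : (\int[Pr]_w (expR (a * X w ^+ 2))%:E =
    \int[Pr]_w \int[lebesgue_measure]_z F (w, z))%E.
  apply: eq_integral => w _; rewrite /F/=.
  under eq_integral do rewrite mulrAC (pdfE (b * X w)) EFinM.
  rewrite ge0_integralZl//; last 2 first.
  - by apply/measurable_EFinP; exact: measurable_normal_pdf.
  - by move=> z _; rewrite lee_fin normal_pdf_ge0.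
  by rewrite integral_normal_pdf mule1 exprMn bE; congr (expR _)%:E; by field.
have -> : (\int[Pr]_w \int[lebesgue_measure]_z F (w, z) =
    \int[lebesgue_measure]_z \int[Pr]_w F (w, z))%E.
  exact: (@fubini_tonelli _ _ _ _ _ Pr lebesgue_measure F).
apply: (@le_trans _ _ (\int[lebesgue_measure]_z (s * normal_pdf 0 s z)%:E)%E).
  apply: ge0_le_integral => //.
  - by move=> z _; apply: integral_ge0.
  - exact: measurable_fun_fubini_tonelli_G.
  - apply/measurable_EFinP/measurable_funM => //; exact: measurable_normal_pdf.
  move=> z _; rewrite /F /=.
  under eq_integral do rewrite mulrC EFinM.
  rewrite ge0_integralZl//; last 2 first.
  - by apply/measurable_EFinP/measurableT_comp => //; exact: measurable_funM.
  - by rewrite lee_fin normal_pdf_ge0.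
  (* Since 1 - 2a = 1/s^2, the factor exp((b z)^2 / 2) widens the standard normal density to
     standard deviation s, up to the normalisation s. *)
  have -> : (s * normal_pdf 0 s z = normal_pdf 0 1 z * expR ((b * z) ^+ 2 / 2))%R.
    rewrite !normal_pdfE ?oner_neq0 ?gt_eqF//.
    have -> : normal_fun 0 s z = (normal_fun 0 1 z * expR ((b * z) ^+ 2 / 2))%R.
      rewrite /normal_fun -expRD exprMn bE sE; congr expR.
      by field; rewrite gt_eqF.
    rewrite !mulrA; congr (_ * _ * _); rewrite /normal_peak expr1n mul1r -mulrnAr.
    rewrite sqrtrM ?sqr_ge0// sqrtr_sqr gtr0_norm// invfM mulrA.
    by rewrite divff ?gt_eqF// mul1r.
  by rewrite EFinM lee_wpmul2l// lee_fin normal_pdf_ge0.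
under eq_integral do rewrite EFinM.
rewrite ge0_integralZl//; last 3 first.
- by apply/measurable_EFinP; exact: measurable_normal_pdf.
- by move=> z _; rewrite lee_fin normal_pdf_ge0.
- by rewrite lee_fin ltW.
by rewrite integral_normal_pdf mule1.
Qed.

(** After squaring, it suffices that 1/(1 - 2a) <= 1 + 16a/7. For nonnegative a this holds precisely
    up to a = 1/16, which fixes the constant 8/7. *)
Lemma sg_expR_sqr_le_expR (a : R) : 0 <= a <= 16^-1 ->
  (\int[Pr]_w (expR (a * X w ^+ 2))%:E <= (expR (8 / 7 * a))%:E)%E.
Proof.
move=> /andP[a0 a16]; apply: le_trans (sg_expR_sqr_le _) _; first by rewrite a0/=; lra.
have s2 : 0 < 1 - 2 * a by lra.
rewrite lee_fin -[leRHS]ger0_norm ?expR_ge0// -sqrtr_sqr -sqrtrV ?(ltW s2)//.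
apply: ler_wsqrtr; rewrite expr2 -expRD.
apply: le_trans (expR_ge1Dx _); rewrite -[(1 - 2 * a)^-1]mul1r ler_pdivrMr//.
nra.
Qed.

(** The variance once [X] is centred; [fine] loses nothing because the integral is finite. *)
Definition second_moment : R := fine (\int[Pr]_w (X w ^+ 2)%:E).

Lemma second_momentE : (\int[Pr]_w (X w ^+ 2)%:E = second_moment%:E)%E.
Proof.
by rewrite fineK//; apply: integrable_fin_num => //; exact: sg_sqr_integrable.
Qed.

Lemma second_moment_ge0 : 0 <= second_moment.
Proof. by apply/fine_ge0/integral_ge0 => w _; rewrite lee_fin sqr_ge0. Qed.

Lemma integral_affine_sqr (b a : R) :
  (\int[Pr]_w (b + a * X w ^+ 2)%:E = (b + a * second_moment)%:E)%E.
Proof.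
under eq_integral do rewrite EFinD EFinM.
rewrite integralD//; last 2 first.
- exact: finite_measure_integrable_cst.
- exact: integrableZl sg_sqr_integrable.
rewrite integralZl//; last exact: sg_sqr_integrable.
by rewrite second_momentE integral_probability_cst.
Qed.

(* Compare both sides of [sg_expR_sqr_le] to first order as a tends to 0. *)
Lemma second_moment_le1 : second_moment <= 1.
Proof.
set s := second_moment.
have h (a : R) : 0 < a <= 16^-1 -> s <= (1 - 3 * a)^-1.
  move=> /andP[a0 a16].
  have : (1 + a * s <= (Num.sqrt (1 - 2 * a))^-1).
    rewrite -lee_fin; apply: le_trans (sg_expR_sqr_le _); last by rewrite ltW//=; lra.
    rewrite -integral_affine_sqr; apply: ge0_le_integral => //.
    - by move=> w _; rewrite lee_fin addr_ge0// mulr_ge0 ?sqr_ge0// ltW.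
    - by apply/measurable_EFinP/measurable_funD => //; apply: measurable_funM => //;
        exact: measurable_funX.
    - by apply/measurable_EFinP/measurableT_comp => //; apply: measurable_funM => //;
        exact: measurable_funX.
    - by move=> w _; rewrite lee_fin expR_ge1Dx.
  move=> h.
  have {}h : (1 + a * s) ^+ 2 * (1 - 2 * a) <= 1.
    have q0 : 0 < 1 - 2 * a by lra.
    rewrite -ler_pdivlMr// div1r -[(1 - 2 * a)^-1]sqr_sqrtr ?invr_ge0 ?(ltW q0)//.
    have s0 := second_moment_ge0.
    by rewrite lerXn2r ?nnegrE ?sqrtr_ge0 ?addr_ge0 ?mulr_ge0 ?(ltW a0)// sqrtrV ?(ltW q0).
  rewrite -[leRHS]mul1r ler_pdivlMr; last lra.
  have : a * (s * (1 - 3 * a)) <= a * 1; last by rewrite ler_pM2l.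
  nra.
case: (lerP s 1) => // s1.
(* If s > 1, this choice gives s (1 - 3a) >= (s + 1)/2 > 1, against [h]. *)
pose a := Num.min 16^-1 ((s - 1) / (6 * s)).
have a0 : 0 < a by rewrite lt_min invr_gt0 ltr0n/= divr_gt0//; lra.
have a16 : a <= 16^-1 by rewrite ge_min lexx.
have as1 : a * (6 * s) <= s - 1.
  by rewrite -ler_pdivlMr; [rewrite ge_min lexx orbT|lra].
have := h a; rewrite a0 a16 => /(_ isT).
by rewrite -[leRHS]mul1r ler_pdivlMr; lra.
Qed.

(** Expand to second order: the linear term has mean zero, and the remainder is at most a^2 times an
    integrable exponential of X^2. *)
Lemma sg_expR_centered_sqr_le (a : R) : `|a| <= 16^-1 ->
  (\int[Pr]_w (expR (a * (X w ^+ 2 - second_moment)))%:E <= (expR (40 * a ^+ 2))%:E)%E.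
Proof.
set s := second_moment => a16.
have s0 : 0 <= s := second_moment_ge0.
have s1 : s <= 1 := second_moment_le1.
(* 5/16 = 1/4 + 1/16: with y = X^2 - s, one quarter of |y| in the exponent absorbs the factor y^2
   and the rest covers |a| <= 1/16. As 0 <= s <= 1, |y| <= 1 + X^2. *)
have ie : Pr.-integrable setT (fun w => (expR (5 / 16 * X w ^+ 2))%:E).
  apply/integrableP; split.
    by apply/measurable_EFinP/measurableT_comp => //; apply: measurable_funM => //;
      exact: measurable_funX.
  under eq_integral do rewrite gee0_abs ?lee_fin ?expR_ge0//.
  by apply: le_lt_trans (sg_expR_sqr_le _) (ltry _); lra.
pose c := 16 * expR (5 / 16) * a ^+ 2.
have pt w : expR (a * (X w ^+ 2 - s)) <= 1 + a * (X w ^+ 2 - s) + c * expR (5 / 16 * X w ^+ 2).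
  apply: le_trans (expR_le_quadratic _) _; rewrite lerD2l exprMn normrM.
  set y := X w ^+ 2 - s.
  have y2 : y ^+ 2 <= 16 * expR (4^-1 * `|y|).
    have := @sqr_le_expR _ (4^-1 * `|y|); rewrite exprMn real_normK ?num_real// => /(_ _).
    by move=> /(_ ltac:(by rewrite mulr_ge0)); lra.
  have yX : `|y| <= 1 + X w ^+ 2.
    by rewrite ler_norml /y; have := sqr_ge0 (X w); lra.
  have E : expR (4^-1 * `|y|) * expR (`|a| * `|y|) <= expR (5 / 16) * expR (5 / 16 * X w ^+ 2).
    rewrite -!expRD ler_expR; have := normr_ge0 y; have := normr_ge0 a; nra.
  have -> : c * expR (5 / 16 * X w ^+ 2) =
      a ^+ 2 * (16 * (expR (5 / 16) * expR (5 / 16 * X w ^+ 2))) by rewrite /c; ring.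
  rewrite -[leLHS]mulrA; apply: ler_wpM2l; first exact: sqr_ge0.
  apply: le_trans (_ : 16 * (expR (4^-1 * `|y|) * expR (`|a| * `|y|)) <= _);
    last by rewrite ler_wpM2l.
  by rewrite mulrA ler_wpM2r ?expR_ge0.
have c0 : 0 <= c by apply: mulr_ge0; [apply: mulr_ge0; rewrite ?expR_ge0|exact: sqr_ge0].
apply: (@le_trans _ _ (\int[Pr]_w ((1 - a * s + a * X w ^+ 2)%:E + c%:E * (expR
  (5 / 16 * X w ^+ 2))%:E))%E).
  apply: ge0_le_integral => //.
  - apply/measurable_EFinP/measurableT_comp => //; apply: measurable_funM => //.
    by apply: measurable_funB => //; exact: measurable_funX.
  - apply: emeasurable_funD; apply/measurable_EFinP.
      by apply: measurable_funD => //; apply: measurable_funM => //; exact: measurable_funX.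
    apply: measurable_funM => //; apply: measurableT_comp => //.
    by apply: measurable_funM => //; exact: measurable_funX.
  - move=> w _; rewrite -EFinM -EFinD lee_fin; apply: le_trans (pt w) _.
    by rewrite mulrBr; lra.
rewrite integralD//; last 2 first.
- apply: (eq_integrable measurableT (fun w => ((1 - a * s)%:E + a%:E * (X w ^+ 2)%:E)%E)) => //.
  apply: integrableD => //; first exact: finite_measure_integrable_cst.
  exact: integrableZl sg_sqr_integrable.
- exact: integrableZl.
rewrite integral_affine_sqr integralZl// subrK.
apply: (@le_trans _ _ (1%:E + c%:E * ((Num.sqrt (1 - 2 * (5 / 16)))^-1)%:E)%E).
  by rewrite leeD2l// lee_wpmul2l// sg_expR_sqr_le//; lra.
rewrite -EFinM -EFinD lee_fin; apply: le_trans (expR_ge1Dx _); rewrite lerD2l.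
(* The numerical constant: 16 (16/11) (17/10) is just below 40. *)
have h1 : expR (5 / 16) <= 16 / 11 :> R.
  have := expR_ge1Dx (- (5 / 16) : R); rewrite expRN => h.
  have e0 := expR_gt0 (5 / 16 : R).
  have : 11 / 16 * expR (5 / 16) <= 1 :> R by rewrite -ler_pdivlMr// div1r; lra.
  lra.
have h2 : (Num.sqrt (1 - 2 * (5 / 16)))^-1 <= 17 / 10 :> R.
  rewrite -sqrtrV; last lra.
  rewrite -(@ger0_norm _ (17 / 10 : R))// -sqrtr_sqr ler_wsqrtr//.
  by rewrite -[leLHS]mul1r ler_pdivrMr; lra.
have h2' : 0 <= (Num.sqrt (1 - 2 * (5 / 16)))^-1 :> R by rewrite invr_ge0.
rewrite /c mulrAC [leRHS](_ : _ = a ^+ 2 * 40) 1?mulrC// ler_wpM2l ?sqr_ge0//.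
have : 16 * expR (5 / 16) * (Num.sqrt (1 - 2 * (5 / 16)))^-1 <= 16 * (16 / 11) * (17 / 10) :> R.
  by apply: ler_pM => //; rewrite ?mulr_ge0 ?expR_ge0 ?ler_pM2l.
lra.
Qed.

End sub_gaussian_moments.

(** * Finite sums, convexity of the exponential, averages over subsets *)

Section finite_sums.
Context (R : realType).

(** Cauchy-Schwarz, by Lagrange's identity. *)
Lemma sum_mul_sqr_le (J : finType) (a b : J -> R) :
  (\sum_i a i * b i) ^+ 2 <= (\sum_i a i ^+ 2) * (\sum_i b i ^+ 2).
Proof.
have : 0 <= \sum_i \sum_j (a i * b j - a j * b i) ^+ 2.
  by apply: sumr_ge0 => i _; apply: sumr_ge0 => j _; exact: sqr_ge0.
have -> : \sum_i \sum_j (a i * b j - a j * b i) ^+ 2 =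
    2 * ((\sum_i a i ^+ 2) * (\sum_i b i ^+ 2) - (\sum_i a i * b i) ^+ 2).
  rewrite expr2 !big_distrlr/=.
  have -> : \sum_i \sum_j (a i * b j - a j * b i) ^+ 2 =
     \sum_i \sum_j a i ^+ 2 * b j ^+ 2 + \sum_i \sum_j a j ^+ 2 * b i ^+ 2
     - 2 * \sum_i \sum_j a i * b i * (a j * b j).
    rewrite mulr_sumr -sumrN -!big_split/=; apply: eq_bigr => i _.
    rewrite mulr_sumr -sumrN -!big_split/=; apply: eq_bigr => j _; ring.
  by rewrite [X in _ + X - _]exchange_big/=; ring.
by rewrite pmulr_rge0// subr_ge0.
Qed.

(** Jensen's inequality for the uniform mean, from the tangent line of exp at the mean [m]. The
    point [j0] makes the index type nonempty. *)
Lemma expR_mean_le (J : finType) (j0 : J) (a : J -> R) :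
  expR ((\sum_j a j) / #|J|%:R) <= (\sum_j expR (a j)) / #|J|%:R.
Proof.
have N0 : 0 < #|J|%:R :> R by rewrite ltr0n; apply/card_gt0P; exists j0.
set m := _ / _; rewrite ler_pdivlMr//.
have -> : expR m * #|J|%:R = \sum_j expR m * (1 + (a j - m)).
  rewrite -mulr_sumr big_split/= sumr_const big_split/= sumrN sumr_const.
  by rewrite -(mulr_natr m) /m divfK ?gt_eqF// subrr addr0.
apply: ler_sum => j _; rewrite -[a j in leRHS](subrK m) [_ - _ + _]addrC expRD.
by rewrite ler_wpM2l ?expR_ge0// expR_ge1Dx.
Qed.

Lemma expR_sum (J : Type) (s : seq J) (P : pred J) (a : J -> R) :
  expR (\sum_(j <- s | P j) a j) = \prod_(j <- s | P j) expR (a j).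
Proof. by apply: big_morph; [exact: expRD|exact: expR0]. Qed.

(** Toggling the membership of [i] is an involution of the subsets that changes the sign of [f]. *)
Lemma sum_sign_sets (n : nat) (i : 'I_n) (f : {set 'I_n} -> R) :
  (forall I, f (i |: I) = - f (I :\ i)) -> \sum_(I : {set 'I_n}) f I = 0.
Proof.
move=> fi; pose t (I : {set 'I_n}) := if i \in I then I :\ i else i |: I.
have tt : involutive t.
  move=> I; rewrite /t; have [iI|iI] := boolP (i \in I).
    by rewrite !inE eqxx/= finset.setD1K.
  by rewrite !inE eqxx/= finset.setU1K.
have E : \sum_(I : {set 'I_n}) f I = \sum_(I : {set 'I_n}) - f I.
  rewrite [LHS](reindex_inj (inv_inj tt))/=; apply: eq_bigr => I _.
  rewrite /t; have [iI|iI] := boolP (i \in I).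
    rewrite (_ : f I = - f (I :\ i)) ?opprK// -fi; congr f.
    by apply/setP => j; rewrite !inE; case: eqP => // ->; rewrite iI.
  by rewrite fi; congr (- f _); apply/setP => j; rewrite !inE; case: eqP => // ->;
    rewrite (negbTE iI).
by move: E; rewrite sumrN => E; lra.
Qed.

(** A uniform random subset contains i but not j with probability 1/4. With signs e_i, e_j for
    membership, the indicator is (1 + e_i)(1 - e_j)/4, and all nonconstant terms sum to zero. *)
Lemma sum_separating_sets (n : nat) (i j : 'I_n) : i != j ->
  4 * \sum_(I : {set 'I_n}) (if (i \in I) && (j \notin I) then 1 else 0) =
  #|{set 'I_n}|%:R :> R.
Proof.
move=> ij; pose e (k : 'I_n) (I : {set 'I_n}) : R := if k \in I then 1 else -1.
have -> : 4 * \sum_(I : {set 'I_n}) (if (i \in I) && (j \notin I) then 1 else 0) =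
    \sum_(I : {set 'I_n}) 1 + \sum_(I : {set 'I_n}) e i I - \sum_(I : {set 'I_n}) e j I
      - \sum_(I : {set 'I_n}) e i I * e j I :> R.
  rewrite mulr_sumr -!sumrN -!big_split/=; apply: eq_bigr => I _; rewrite /e.
  by case: (i \in I); case: (j \in I) => /=; ring.
have e0 k : \sum_(I : {set 'I_n}) e k I = 0.
  by apply: (@sum_sign_sets _ k) => I; rewrite /e !inE eqxx/= opprK.
have eij : \sum_(I : {set 'I_n}) e i I * e j I = 0.
  apply: (@sum_sign_sets _ i) => I.
  by rewrite /e !inE eqxx/= eq_sym (negbTE ij)/= mulN1r mul1r opprK.
by rewrite sumr_const !e0 eij !subr0 addr0.
Qed.

Lemma expR_half_sum_le (x y : R) :
  expR (x + y) <= 2^-1 * expR (2 * x) + 2^-1 * expR (2 * y).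
Proof.
rewrite expRD (_ : 2 * x = x + x) 1?(_ : 2 * y = y + y) ?expRD; [|ring|ring].
have := sqr_ge0 (expR x - expR y); nra.
Qed.

End finite_sums.

(** * Exponential moments and variances of independent sums *)

Section independent_sub_gaussian.
Context (R : realType) (d : measure_display) (T : measurableType d).
Context (Pr : probability T R) (n : nat) (X : 'I_n -> T -> R).
Hypothesis mX : forall i, measurable_fun setT (X i).
Hypothesis indX : independent_family Pr X.

(** Induction on [s]: resampling the single coordinate [k] integrates its factor while the remaining
    product is frozen. *)
Lemma integral_prod_le (f : 'I_n -> R -> R) (c : 'I_n -> R) (s : seq 'I_n) :
  uniq s -> (forall i, measurable_fun setT (f i)) -> (forall i x, 0 <= f i x) ->
  (forall i, (\int[Pr]_w (f i (X i w))%:E <= (c i)%:E)%E) ->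
  (\int[Pr]_w (\prod_(i <- s) f i (X i w))%:E <= (\prod_(i <- s) c i)%:E)%E.
Proof.
move=> us mf f0 fc; elim: s us => [_|k s ih /= /andP[ks us]].
  by under eq_integral do rewrite big_nil; rewrite big_nil integral_probability_cst.
have mfX i : measurable_fun setT (fun w => f i (X i w)) by exact: measurableT_comp.
have c0 i : 0 <= c i.
  by rewrite -lee_fin; apply: le_trans (fc i); apply: integral_ge0 => w _; rewrite lee_fin.
have p0 w : 0 <= \prod_(i <- s) f i (X i w) by apply: prodr_ge0 => i _; exact: f0.
have mp : measurable_fun setT (fun w => \prod_(i <- s) f i (X i w)).
  by apply: measurable_prod => i _; exact: mfX.
apply: le_trans (_ : \int[Pr]_w' (c k * \prod_(i <- s) f i (X i w'))%:E <= _)%E.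
  apply: (resample_le mX indX (I := [set k]) (h := fun x => \prod_(i <- k :: s) f i (x i))).
  - apply: measurable_prod => i _; apply: measurableT_comp => //; exact: measurable_tnth.
  - by move=> x; apply: prodr_ge0 => i _; exact: f0.
  - exact: measurable_funM.
  move=> w'; under eq_integral => w _.
    rewrite big_cons {1}/mix inE eqxx mulrC (eq_big_seq (fun i => f i (X i w'))).
      rewrite EFinM; over.
    move=> i si; rewrite /mix inE; case: eqP => // ik; by rewrite ik (negbTE ks) in si.
  rewrite ge0_integralZl//; last 3 first.
  - exact/measurable_EFinP.
  - by move=> w _; rewrite lee_fin.
  - by rewrite lee_fin.
  by rewrite mulrC EFinM lee_wpmul2l ?lee_fin.
under eq_integral do rewrite EFinM.
rewrite ge0_integralZl//; last 3 first.
- exact/measurable_EFinP.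
- by move=> w _; rewrite lee_fin.
- by rewrite lee_fin.
by rewrite big_cons EFinM lee_wpmul2l ?lee_fin ?ih.
Qed.

Lemma integral_expR_sum_le (f : 'I_n -> R -> R) (c : 'I_n -> R) :
  (forall i, measurable_fun setT (f i)) ->
  (forall i, (\int[Pr]_w (expR (f i (X i w)))%:E <= (expR (c i))%:E)%E) ->
  (\int[Pr]_w (expR (\sum_i f i (X i w)))%:E <= (expR (\sum_i c i))%:E)%E.
Proof.
move=> mf fc; under eq_integral do rewrite expR_sum.
rewrite expR_sum; apply: (integral_prod_le (f := fun i x => expR (f i x))) => //.
- exact: index_enum_uniq.
- by move=> i; exact: measurableT_comp.
Qed.

Hypothesis sgX : forall i (l : R),
  (\int[Pr]_w (expR (l * X i w))%:E <= (expR (l ^+ 2 / 2))%:E)%E.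

Let m i := second_moment Pr (X i).

Lemma integral_expR_linear_le (b : 'I_n -> R) :
  (\int[Pr]_w (expR (\sum_i b i * X i w))%:E <= (expR ((\sum_i b i ^+ 2) / 2))%:E)%E.
Proof.
rewrite mulr_suml; apply: (integral_expR_sum_le (f := fun i x => b i * x)) => //.
by move=> i; exact: measurable_funM.
Qed.

Hypothesis X0 : forall i, (\int[Pr]_w (X i w)%:E = 0)%E.

(** Independent centred variables are orthogonal: when coordinate [k] is resampled, the cross term
    is linear in it and integrates to zero. *)
Lemma integral_linear_sqr (b : 'I_n -> R) :
  (\int[Pr]_w ((\sum_i b i * X i w) ^+ 2)%:E = (\sum_i b i ^+ 2 * m i)%:E)%E.
Proof.
have : uniq (index_enum 'I_n) by exact: index_enum_uniq.
move: (index_enum _) => s; elim: s => [_|k s ih /= /andP[ks us]].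
  under eq_integral do rewrite big_nil expr0n/=.
  by rewrite big_nil integral_probability_cst.
rewrite (resample mX indX [set k] (h := fun x => (\sum_(i <- k :: s) b i * x i) ^+ 2));
  last 2 first.
- apply: measurable_funX; apply: measurable_sum => i; apply: measurable_funM => //;
    exact: measurable_tnth.
- by move=> x; exact: sqr_ge0.
pose y w := \sum_(i <- s) b i * X i w.
have my : measurable_fun setT y by apply: measurable_sum => i; exact: measurable_funM.
have inner w' : (\int[Pr]_w ((\sum_(i <- k :: s) b i * mix X [set k] w' w i) ^+ 2)%:E =
    (b k ^+ 2 * m k)%:E + (y w' ^+ 2)%:E)%E.
  transitivity (\int[Pr]_w ((y w' ^+ 2 + b k ^+ 2 * X k w ^+ 2)%:E +
      (2 * b k * y w')%:E * (X k w)%:E))%E.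
    apply: eq_integral => w _; rewrite big_cons {1}/mix inE eqxx.
    rewrite (eq_big_seq (fun i => b i * X i w')); last first.
      move=> i si; rewrite /mix inE; case: eqP => // ik; by rewrite ik (negbTE ks) in si.
    by rewrite -EFinM -EFinD; congr (_%:E); rewrite -/(y w'); ring.
  rewrite integralD//=; last 2 first.
  - apply: (eq_integrable measurableT (fun w => ((y w' ^+ 2)%:E + (b k ^+ 2)%:E *
      (X k w ^+ 2)%:E)%E)) => //.
    apply: integrableD => //; first exact: finite_measure_integrable_cst.
    exact: integrableZl (sg_sqr_integrable (mX k) (sgX k)).
  - exact: integrableZl (sg_integrable (mX k) (sgX k)).
  rewrite integral_affine_sqr// integralZl//; last exact: sg_integrable.
  by rewrite X0 mule0 adde0 -EFinD addrC.
under eq_integral do rewrite inner.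
rewrite ge0_integralD//; last 3 first.
- by move=> w _; rewrite lee_fin mulr_ge0 ?sqr_ge0// second_moment_ge0.
- by move=> w _; rewrite lee_fin sqr_ge0.
- by apply/measurable_EFinP/measurable_funX.
by rewrite integral_probability_cst ih// big_cons.
Qed.

End independent_sub_gaussian.

(** * Hanson-Wright bounds *)

Section quadratic_forms.
Context (R : realType) (n : nat) (J : finType) (C : J -> 'I_n -> R).

(** This is |C y|^2, so that [gram] below is the matrix C^T C. *)
Definition qform (y : 'I_n -> R) : R := \sum_r (\sum_j C r j * y j) ^+ 2.

Definition gram (i j : 'I_n) : R := \sum_r C r i * C r j.

Definition offdiag (y : 'I_n -> R) : R :=
  \sum_i \sum_(j | j != i) gram i j * (y i * y j).

(** The decoupled part of the form, which pairs coordinates in [I] with coordinates outside it. *)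
Definition cross (I : {set 'I_n}) (y : 'I_n -> R) : R :=
  \sum_i \sum_j if (i \in I) && (j \notin I) then gram i j * (y i * y j) else 0.

Definition restr (I : {set 'I_n}) (y : 'I_n -> R) (j : 'I_n) : R :=
  if j \in I then y j else 0.

Lemma qform_ge0 y : 0 <= qform y.
Proof. by apply: sumr_ge0 => r _; exact: sqr_ge0. Qed.

Lemma qform_gram y : qform y = \sum_i \sum_j gram i j * (y i * y j).
Proof.
rewrite /qform; under eq_bigr do rewrite expr2 big_distrlr/=.
rewrite exchange_big/=; apply: eq_bigr => i _.
rewrite exchange_big/=; apply: eq_bigr => j _.
by rewrite /gram mulr_suml; apply: eq_bigr => r _; ring.
Qed.

Lemma qform_diag_off y : qform y = \sum_i gram i i * y i ^+ 2 + offdiag y.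
Proof.
rewrite qform_gram -big_split/=; apply: eq_bigr => i _.
by rewrite (bigD1 i)//= expr2.
Qed.

Lemma gram_diag_ge0 i : 0 <= gram i i.
Proof. by apply: sumr_ge0 => r _; rewrite -expr2 sqr_ge0. Qed.

Lemma sum_gram_diag : \sum_i gram i i = \sum_r \sum_i C r i ^+ 2.
Proof. by rewrite exchange_big. Qed.

(** Decoupling: each ordered pair of distinct indices is separated by a quarter of all subsets. *)
Lemma offdiag_cross y :
  offdiag y = (\sum_(I : {set 'I_n}) 4 * cross I y) / #|{set 'I_n}|%:R.
Proof.
have N0 : #|{set 'I_n}|%:R != 0 :> R.
  by rewrite pnatr_eq0 -lt0n; apply/card_gt0P; exists finset.set0.
apply: (mulIf N0); rewrite divfK// -mulr_sumr /cross exchange_big/=.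
rewrite /offdiag mulr_suml mulr_sumr; apply: eq_bigr => i _.
rewrite exchange_big/= mulr_suml mulr_sumr big_mkcond/=; apply: eq_bigr => j _.
case: ifPn => [ji|/negPn/eqP ->]; last first.
  rewrite big1 ?mulr0// => I _; by case: (i \in I).
rewrite -(@sum_separating_sets R n i j) 1?eq_sym// mulrCA mulr_sumr; congr (_ * _).
by apply: eq_bigr => I _; case: ifP => _; rewrite ?mulr1 ?mulr0.
Qed.

(** Exhibits the cross part as linear in the coordinates of [I], with coefficients that depend only
    on the others. *)
Lemma cross_restr I y :
  cross I y = \sum_i (if i \in I then \sum_j gram i j * restr (~: I) y j else 0) * y i.
Proof.
apply: eq_bigr => i _; case: (i \in I) => /=; last by rewrite mul0r big1.
rewrite mulr_suml; apply: eq_bigr => j _; rewrite /restr inE.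
by case: (j \in I) => /=; ring.
Qed.

Context (kappa : R).
Hypothesis kappa0 : 0 <= kappa.
Hypothesis qform_le : forall y, qform y <= kappa * \sum_j y j ^+ 2.

Lemma gram_diag_le i : gram i i <= kappa.
Proof.
have := qform_le (fun j => if j == i then 1 else 0).
rewrite [X in _ * X](bigD1 i)//= eqxx expr1n big1 ?addr0 ?mulr1; last first.
  by move=> j /negbTE ->; rewrite expr0n.
apply: le_trans; rewrite le_eqVlt; apply/orP; left; apply/eqP.
apply: eq_bigr => r _; rewrite (bigD1 i)//= eqxx big1 ?addr0; first by ring.
by move=> j /negbTE ->; rewrite mulr0.
Qed.

(** With v = C^T C y, |v|^2 is the inner product of C v and C y. Cauchy-Schwarz and the bound on C v
    give |v|^4 <= kappa |v|^2 |C y|^2, and |v|^2 cancels. *)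
Lemma gram_apply_le y : \sum_i (\sum_j gram i j * y j) ^+ 2 <= kappa * qform y.
Proof.
pose u r := \sum_j C r j * y j.
pose v i := \sum_j gram i j * y j.
have vE i : v i = \sum_r C r i * u r.
  rewrite /v /gram; under eq_bigr do rewrite mulr_suml.
  rewrite exchange_big/=; apply: eq_bigr => r _; rewrite mulr_sumr.
  by apply: eq_bigr => j _; rewrite mulrA.
have vv : \sum_i v i ^+ 2 = \sum_r (\sum_i C r i * v i) * u r.
  under eq_bigr do rewrite expr2 {2}vE mulr_sumr.
  rewrite exchange_big/=; apply: eq_bigr => r _; rewrite mulr_suml.
  by apply: eq_bigr => i _; ring.
have h1 : (\sum_i v i ^+ 2) ^+ 2 <= qform v * qform y.
  rewrite [X in X ^+ 2]vv; exact: sum_mul_sqr_le.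
have h2 := qform_le v.
have v0 : 0 <= \sum_i v i ^+ 2 by apply: sumr_ge0 => i _; exact: sqr_ge0.
have y0 := qform_ge0 y.
have [->|vn0] := eqVneq (\sum_i v i ^+ 2) 0; first by rewrite mulr_ge0.
have vp : 0 < \sum_i v i ^+ 2 by rewrite lt_neqAle eq_sym vn0.
rewrite -/(v _) -(ler_pM2l vp) -expr2 (le_trans h1)//.
by rewrite mulrCA mulrA ler_wpM2r.
Qed.

End quadratic_forms.

(** Separates two possibly dependent exponents at the price of doubling each. *)
Lemma integral_expRD_le (R : realType) (d : measure_display)
    (T : measurableType d) (Pr : probability T R) (f g : T -> R) (a b : R) :
  measurable_fun setT f -> measurable_fun setT g ->
  (\int[Pr]_w (expR (2 * f w))%:E <= a%:E)%E ->
  (\int[Pr]_w (expR (2 * g w))%:E <= b%:E)%E ->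
  (\int[Pr]_w (expR (f w + g w))%:E <= (2^-1 * a + 2^-1 * b)%:E)%E.
Proof.
move=> mf mg fa gb.
have mh (h : T -> R) : measurable_fun setT h ->
    measurable_fun setT (fun w => (expR (2 * h w))%:E).
  by move=> mh; apply/measurable_EFinP/measurableT_comp => //; exact: measurable_funM.
apply: (@le_trans _ _ (\int[Pr]_w ((2^-1)%:E * (expR (2 * f w))%:E +
    (2^-1)%:E * (expR (2 * g w))%:E))%E).
  apply: ge0_le_integral => //.
  - by apply/measurable_EFinP/measurableT_comp => //; exact: measurable_funD.
  - by apply: emeasurable_funD; apply: measurable_funeM; exact: mh.
  - by move=> w _; rewrite -!EFinM -EFinD lee_fin expR_half_sum_le.
rewrite ge0_integralD//; last 2 first.
- by apply: measurable_funeM; exact: mh.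
- by apply: measurable_funeM; exact: mh.
rewrite !ge0_integralZl//; [|exact: mh|exact: mh].
by rewrite EFinD !EFinM leeD// lee_wpmul2l// lee_fin.
Qed.

(** * Exponential moments of quadratic forms *)

Section chaos.
Context (R : realType) (d : measure_display) (T : measurableType d).
Context (Pr : probability T R) (n : nat) (X : 'I_n -> T -> R).
Hypothesis mX : forall i, measurable_fun setT (X i).
Hypothesis indX : independent_family Pr X.
Hypothesis sgX : forall i (l : R),
  (\int[Pr]_w (expR (l * X i w))%:E <= (expR (l ^+ 2 / 2))%:E)%E.
Context (J : finType) (kappa tau : R).
Hypothesis kappa0 : 0 <= kappa.

(** [kappa] bounds the squared operator norm and [tau] the squared Frobenius norm; both are fixed
    while [C] ranges over its restrictions to subsets of columns. *)
Let bounded (C : J -> 'I_n -> R) :=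
  (forall y, qform C y <= kappa * \sum_j y j ^+ 2) /\
  \sum_r \sum_j C r j ^+ 2 <= tau.

Lemma measurable_qform d' (T' : measurableType d') (Y : 'I_n -> T' -> R)
    (C : J -> 'I_n -> R) : (forall i, measurable_fun setT (Y i)) ->
  measurable_fun setT (fun w => qform C (Y ^~ w)).
Proof.
move=> mY; apply: measurable_sum => r; apply: measurable_funX.
by apply: measurable_sum => j; exact: measurable_funM.
Qed.

Lemma measurable_restr d' (T' : measurableType d') (Y : 'I_n -> T' -> R) I :
  (forall i, measurable_fun setT (Y i)) ->
  forall i, measurable_fun setT (fun w => restr I (Y ^~ w) i).
Proof. by move=> mY i; rewrite /restr; case: (i \in I). Qed.

Lemma measurable_cross d' (T' : measurableType d') (Y : 'I_n -> T' -> R)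
    (C : J -> 'I_n -> R) I : (forall i, measurable_fun setT (Y i)) ->
  measurable_fun setT (fun w => cross C I (Y ^~ w)).
Proof.
move=> mY; apply: measurable_sum => i; apply: measurable_sum => j.
by case: (_ && _) => //; apply: measurable_funM => //; exact: measurable_funM.
Qed.

Lemma measurable_offdiag d' (T' : measurableType d') (Y : 'I_n -> T' -> R)
    (C : J -> 'I_n -> R) : (forall i, measurable_fun setT (Y i)) ->
  measurable_fun setT (fun w => offdiag C (Y ^~ w)).
Proof.
move=> mY; apply: measurable_sum => i; rewrite /=.
under eq_fun do rewrite big_mkcond/=.
apply: measurable_sum => j; case: (_ != _) => //.
by apply: measurable_funM => //; exact: measurable_funM.
Qed.

(** With the coordinates outside [I] frozen, the exponent is linear in those of [I]. The
    sub-Gaussian bound leaves l^2/2 times a squared norm, which [gram_apply_le] returns to a value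
    of the form itself. *)
Lemma integral_expR_cross_le (C : J -> 'I_n -> R) (I : {set 'I_n}) (l : R) :
  (forall y, qform C y <= kappa * \sum_j y j ^+ 2) ->
  (\int[Pr]_w (expR (l * cross C I (X ^~ w)))%:E <=
   \int[Pr]_w (expR (l ^+ 2 / 2 * kappa * qform C (restr (~: I) (X ^~ w))))%:E)%E.
Proof.
move=> Ck.
apply: (resample_le mX indX (I := I) (h := fun y => expR (l * cross C I y))).
- apply: measurableT_comp => //; apply: measurable_funM => //.
  apply: (@measurable_cross _ _ (fun i (t : n.-tuple R) => tnth t i)) => i.
  exact: measurable_tnth.
- by move=> y; exact: expR_ge0.
- apply: measurableT_comp => //; apply: measurable_funM => //.
  by apply: measurable_qform; exact: measurable_restr.
move=> w'; set yh := restr (~: I) (X ^~ w').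
pose b i := l * (if i \in I then \sum_j gram C i j * yh j else 0).
have E w : l * cross C I (mix X I w' w) = \sum_i b i * X i w.
  rewrite cross_restr mulr_sumr; apply: eq_bigr => i _; rewrite /b /mix.
  case: (i \in I); last by rewrite mulr0 !mul0r mulr0.
  rewrite mulrA; congr (_ * _ * _); apply: eq_bigr => j _; congr (_ * _).
  by rewrite /yh /restr inE; case: (j \in I).
under eq_integral do rewrite E.
apply: le_trans (integral_expR_linear_le mX indX sgX b) _.
rewrite lee_fin ler_expR.
rewrite (_ : l ^+ 2 / 2 * _ * _ = (l ^+ 2 * (kappa * qform C yh)) / 2); last by field.
rewrite ler_wpM2r ?invr_ge0//.
apply: le_trans (_ : l ^+ 2 * \sum_i (\sum_j gram C i j * yh j) ^+ 2 <= _).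
  rewrite mulr_sumr; apply: ler_sum => i _; rewrite /b; case: ifP => _.
    by rewrite exprMn.
  by rewrite mulr0 expr0n/= mulr_ge0 ?sqr_ge0.
by rewrite ler_wpM2l ?sqr_ge0//; exact: gram_apply_le.
Qed.

(** Jensen over the subsets in [offdiag_cross] reduces to one subset at a time; its factor 4
    produces (4l)^2/2 = 8 l^2. *)
Lemma integral_expR_offdiag_le_qform (C : J -> 'I_n -> R) (l b : R) :
  (forall y, qform C y <= kappa * \sum_j y j ^+ 2) ->
  (forall I, (\int[Pr]_w (expR (8 * l ^+ 2 * kappa * qform C (restr I (X ^~ w))))%:E
    <= b%:E)%E) ->
  (\int[Pr]_w (expR (l * offdiag C (X ^~ w)))%:E <= b%:E)%E.
Proof.
move=> Ck hb.
set N : R := #|{set 'I_n}|%:R.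
have N0 : 0 < N by rewrite ltr0n; apply/card_gt0P; exists finset.set0.
have me I : measurable_fun setT (fun w => expR (4 * l * cross C I (X ^~ w)) / N).
  apply: measurable_funM => //; apply: measurableT_comp => //.
  by apply: measurable_funM => //; exact: measurable_cross.
apply: (@le_trans _ _ (\int[Pr]_w (\sum_(I : {set 'I_n}) (expR (4 * l * cross C I
  (X ^~ w)) / N)%:E))%E).
  apply: ge0_le_integral => //.
  - apply/measurable_EFinP; apply: measurableT_comp => //.
    by apply: measurable_funM => //; exact: measurable_offdiag.
  - by apply: emeasurable_sum => I; apply/measurable_EFinP.
  move=> w _; rewrite sumEFin lee_fin offdiag_cross mulrA mulr_sumr.
  under eq_bigr do rewrite mulrA [l * 4]mulrC.
  by rewrite -mulr_suml; exact: (expR_mean_le finset.set0).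
rewrite ge0_integral_sum//; last 2 first.
- by move=> I; apply/measurable_EFinP.
- by move=> I w _; rewrite lee_fin divr_ge0 ?expR_ge0// ltW.
have -> : (b%:E = \sum_(I : {set 'I_n}) (b / N)%:E)%E.
  by rewrite sumEFin sumr_const -mulr_natr divfK// gt_eqF.
apply: lee_sum => I _.
under eq_integral do rewrite mulrC EFinM.
rewrite ge0_integralZl//; last 2 first.
- apply/measurable_EFinP; apply: measurableT_comp => //.
  by apply: measurable_funM => //; exact: measurable_cross.
- by rewrite lee_fin invr_ge0 ltW.
rewrite [in leRHS](mulrC b) EFinM lee_wpmul2l ?lee_fin ?invr_ge0 ?(ltW N0)//.
apply: le_trans (integral_expR_cross_le _ _ Ck) _.
by rewrite (_ : (4 * l) ^+ 2 / 2 = 8 * l ^+ 2)//; field.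
Qed.

Lemma qform_restr (C : J -> 'I_n -> R) (I : {set 'I_n}) y :
  qform (fun r j => if j \in I then C r j else 0) y = qform C (restr I y).
Proof.
apply: eq_bigr => r _; congr (_ ^+ 2); apply: eq_bigr => j _; rewrite /restr.
by case: ifP => _; rewrite ?mul0r ?mulr0.
Qed.

Lemma restr_sqr_le (I : {set 'I_n}) (y : 'I_n -> R) :
  \sum_j restr I y j ^+ 2 <= \sum_j y j ^+ 2.
Proof.
by apply: ler_sum => j _; rewrite /restr; case: ifP => // _; rewrite expr0n sqr_ge0.
Qed.

Lemma bounded_restr (C : J -> 'I_n -> R) (I : {set 'I_n}) : bounded C ->
  bounded (fun r j => if j \in I then C r j else 0).
Proof.
move=> [Ck Ct]; split.
  move=> y; rewrite qform_restr; apply: le_trans (Ck _) _.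
  by rewrite ler_wpM2l// restr_sqr_le.
apply: le_trans Ct; apply: ler_sum => r _; apply: ler_sum => j _.
by case: ifP => // _; rewrite expr0n sqr_ge0.
Qed.

(** Each diagonal entry is at most [kappa], so the one-variable bound applies, and the trace of the
    Gram matrix is the squared Frobenius norm. *)
Lemma integral_expR_diag_le (C : J -> 'I_n -> R) (th : R) :
  bounded C -> 0 <= th -> th * kappa <= 16^-1 ->
  (\int[Pr]_w (expR (th * \sum_i gram C i i * X i w ^+ 2))%:E <=
   (expR (8 / 7 * th * tau))%:E)%E.
Proof.
move=> [Ck Ct] th0 thk; have g0 := gram_diag_ge0 C; have gk := gram_diag_le Ck.
under eq_integral do rewrite mulr_sumr.
apply: le_trans (_ : (expR (\sum_i 8 / 7 * (th * gram C i i)))%:E <= _)%E.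
  apply: (integral_expR_sum_le mX indX (f := fun i x => th * (gram C i i * x ^+ 2))).
    by move=> i; apply: measurable_funM => //; apply: measurable_funM => //;
      exact: measurable_funX.
  move=> i; under eq_integral do rewrite mulrA.
  apply: sg_expR_sqr_le_expR => //; rewrite mulr_ge0//=.
  by apply: le_trans thk; rewrite ler_wpM2l.
rewrite lee_fin ler_expR -mulr_sumr -mulr_sumr sum_gram_diag mulrA.
by rewrite ler_wpM2l// mulr_ge0.
Qed.

(** Decoupling the off-diagonal part at the doubled parameter 2 th produces the exponent 8 (2 th)^2
    kappa, at most th when 32 th kappa <= 1. That part is thus controlled by the same moments over
    smaller index sets. *)
Lemma integral_expR_qform_le (C : J -> 'I_n -> R) (th : R) (I : {set 'I_n}) :
  bounded C -> 0 <= th -> 32 * (th * kappa) <= 1 ->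
  (\int[Pr]_w (expR (th * qform C (restr I (X ^~ w))))%:E <=
   (expR (16 / 7 * th * tau))%:E)%E.
Proof.
move=> Cb th0 thk.
have thk0 : 0 <= th * kappa by rewrite mulr_ge0.
have mq I' c : measurable_fun setT (fun w => (expR (c * qform C (restr I' (X ^~ w))))%:E).
  apply/measurable_EFinP/measurableT_comp => //; apply: measurable_funM => //.
  by apply: measurable_qform; exact: measurable_restr.
pose phi I' := (\int[Pr]_w (expR (th * qform C (restr I' (X ^~ w))))%:E)%E.
(* Absorbing half of the maximum later requires it to be finite; the crude bound of the form by
   kappa |X|^2 ensures this. *)
have phifin I' : phi I' \is a fin_num.
  rewrite ge0_fin_numE; last by apply: integral_ge0 => w _; rewrite lee_fin expR_ge0.
  apply: le_lt_trans (ltry (expR (\sum_(i < n) 8 / 7 * (th * kappa)))).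
  apply: (@le_trans _ _ (\int[Pr]_w (expR (\sum_i th * kappa * X i w ^+ 2))%:E)%E).
    apply: ge0_le_integral => //.
    - apply/measurable_EFinP/measurableT_comp => //; apply: measurable_sum => i.
      by apply: measurable_funM => //; exact: measurable_funX.
    move=> w _; rewrite lee_fin ler_expR -mulr_sumr -mulrA ler_wpM2l//.
    by apply: le_trans (Cb.1 _) _; rewrite ler_wpM2l// restr_sqr_le.
  apply: (integral_expR_sum_le mX indX (f := fun i x => th * kappa * x ^+ 2)).
    by move=> i; apply: measurable_funM => //; exact: measurable_funX.
  by move=> i; apply: sg_expR_sqr_le_expR => //; lra.
(* The self-bounding step: phi I0 <= (b + phi I0) / 2 at the maximiser I0. *)
pose I0 := [arg max_(I' > I) fine (phi I')]%O.
have phi_max I' : (phi I' <= phi I0)%E.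
  rewrite -[phi I']fineK// -[phi I0]fineK// lee_fin /I0.
  by case: arg_maxP => // j _; apply.
apply: le_trans (phi_max I) _.
pose C0 r j := if j \in I0 then C r j else 0.
have C0b : bounded C0 by exact: bounded_restr.
set b := expR (16 / 7 * th * tau).
have hd : (\int[Pr]_w (expR (2 * (th * \sum_i gram C0 i i * X i w ^+ 2)))%:E <= b%:E)%E.
  under eq_integral do rewrite mulrA.
  rewrite /b (_ : 16 / 7 * th * tau = 8 / 7 * (2 * th) * tau); last by field.
  by apply: integral_expR_diag_le => //; lra.
have ho : (\int[Pr]_w (expR (2 * (th * offdiag C0 (X ^~ w))))%:E <= (fine (phi I0))%:E)%E.
  under eq_integral do rewrite mulrA.
  apply: integral_expR_offdiag_le_qform; first exact: C0b.1.
  move=> I'; rewrite fineK//; apply: le_trans (phi_max (I' :&: I0)).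
  apply: ge0_le_integral => //.
  - apply/measurable_EFinP/measurableT_comp => //; apply: measurable_funM => //.
    by apply: measurable_qform; exact: measurable_restr.
  move=> w _; rewrite lee_fin ler_expR qform_restr.
  have -> : restr I0 (restr I' (X ^~ w)) = restr (I' :&: I0) (X ^~ w).
    by apply/funext => j; rewrite /restr !inE; do 2 case: (j \in _).
  rewrite ler_wpM2r ?qform_ge0//.
  by have := ler_wpM2l th0 thk; lra.
have : (phi I0 <= (2^-1 * b + 2^-1 * fine (phi I0))%:E)%E.
  rewrite {1}/phi; under eq_integral do rewrite -qform_restr qform_diag_off mulrDr.
  apply: integral_expRD_le; [| |exact: hd|exact: ho].
    apply: measurable_funM => //; apply: measurable_sum => i.
    by apply: measurable_funM => //; exact: measurable_funX.
  by apply: measurable_funM => //; exact: measurable_offdiag.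
by rewrite -[phi I0]fineK// !lee_fin; lra.
Qed.

(** Here th = 8 l^2 kappa, so the condition 32 th kappa <= 1 reads (16 |l| kappa)^2 <= 1, and 8
    (16/7) = 128/7. *)
Lemma integral_expR_offdiag_le (C : J -> 'I_n -> R) (l : R) :
  bounded C -> 16 * (`|l| * kappa) <= 1 ->
  (\int[Pr]_w (expR (l * offdiag C (X ^~ w)))%:E <=
   (expR (128 / 7 * l ^+ 2 * kappa * tau))%:E)%E.
Proof.
move=> Cb lk; apply: integral_expR_offdiag_le_qform; first exact: Cb.1.
move=> I; rewrite (_ : 128 / 7 * _ * _ * _ = 16 / 7 * (8 * l ^+ 2 * kappa) * tau); last by field.
apply: integral_expR_qform_le => //; first by rewrite mulr_ge0// mulr_ge0// sqr_ge0.
rewrite -(real_normK (num_real l)).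
have := normr_ge0 l; have : 0 <= `|l| * kappa by rewrite mulr_ge0.
nra.
Qed.

(** Doubling the exponents, the diagonal contributes 40 (2l)^2 = 160 l^2 times the sum of the
    squared diagonal entries, which is at most kappa tau. The off-diagonal part contributes only
    512/7 < 160. *)
Lemma integral_expR_centered_qform_le (C : J -> 'I_n -> R) (l : R) :
  bounded C -> 32 * (`|l| * kappa) <= 1 ->
  (\int[Pr]_w (expR (l * (qform C (X ^~ w) - \sum_i gram C i i * second_moment Pr (X i))))%:E <=
   (expR (160 * l ^+ 2 * kappa * tau))%:E)%E.
Proof.
move=> Cb lk; have g0 := gram_diag_ge0 C; have gk := gram_diag_le Cb.1.
set b := expR _.
have b2 : b = 2^-1 * b + 2^-1 * b by field.
have t0 : \sum_i gram C i i ^+ 2 <= kappa * tau.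
  apply: le_trans (_ : \sum_i kappa * gram C i i <= _).
    by apply: ler_sum => i _; rewrite expr2 ler_wpM2r.
  by rewrite -mulr_sumr sum_gram_diag ler_wpM2l//; exact: Cb.2.
rewrite b2; under eq_integral => w _.
  rewrite qform_diag_off addrAC mulrDr -sumrB.
  under eq_bigr do rewrite -mulrBr.
  over.
apply: integral_expRD_le.
- apply: measurable_funM => //; apply: measurable_sum => i; apply: measurable_funM => //.
  by apply: measurable_funB => //; exact: measurable_funX.
- by apply: measurable_funM => //; exact: measurable_offdiag.
- under eq_integral do rewrite mulrA mulr_sumr.
  apply: le_trans (_ : (expR (\sum_i 40 * (2 * l * gram C i i) ^+ 2))%:E <= _)%E.
    apply: (integral_expR_sum_le mX indX
      (f := fun i x => 2 * l * (gram C i i * (x ^+ 2 - second_moment Pr (X i))))).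
      move=> i; apply: measurable_funM => //; apply: measurable_funM => //.
      by apply: measurable_funB => //; exact: measurable_funX.
    move=> i; under eq_integral do rewrite mulrA.
    apply: sg_expR_centered_sqr_le => //; rewrite !normrM (ger0_norm (g0 i)) ger0_norm//.
    by have := ler_wpM2l (normr_ge0 l) (gk i); lra.
  rewrite lee_fin ler_expR.
  under eq_bigr do rewrite exprMn.
  rewrite -mulr_sumr -mulr_sumr.
  by have := ler_wpM2l (sqr_ge0 l) t0; rewrite exprMn; lra.
under eq_integral do rewrite mulrA.
apply: le_trans (integral_expR_offdiag_le Cb _) _.
  by rewrite normrM ger0_norm//; lra.
rewrite lee_fin ler_expR exprMn.
have kt : 0 <= kappa * tau by apply: le_trans t0; apply: sumr_ge0 => i _; exact: sqr_ge0.
by have := mulr_ge0 (sqr_ge0 l) kt; lra.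
Qed.

End chaos.

(** * Independent signs *)

Section rademacher.
Context (R : realType).

(** The hyperbolic cosine. *)
Let ch (y : R) := (expR y + expR (- y)) / 2.

Let ch_ge0 y : 0 <= ch y.
Proof. by rewrite divr_ge0// addr_ge0// expR_ge0. Qed.

(** cosh(2y) = 2c^2 - 1 with c = cosh y, and (c^2 - 1)^2 >= 0. *)
Let ch_double y : ch (2 * y) <= ch y ^+ 4.
Proof.
have ef : expR y * expR (- y) = 1 by rewrite -expRD subrr expR0.
have -> : ch (2 * y) = 2 * ch y ^+ 2 - 1.
  rewrite /ch (_ : 2 * y = y + y) 1?opprD ?expRD; last by ring.
  have -> : 2 * ((expR y + expR (- y)) / 2) ^+ 2 - 1 =
    (expR y * expR y + expR (- y) * expR (- y)) / 2 + (expR y * expR (- y) - 1) by field.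
  by rewrite ef subrr addr0.
by have := sqr_ge0 (ch y ^+ 2 - 1); rewrite sqrrB1 -exprM; lra.
Qed.

(** cosh y - 1 = (exp(y/2) - exp(-y/2))^2 / 2, and for y >= 0 the difference is at most y
    exp(y/2). *)
Let ch_small y : ch y <= expR (y ^+ 2 / 2 * expR `|y|).
Proof.
wlog y0 : y / 0 <= y.
  move=> h; have [/h//|/ltW y0] := leP 0 y.
  have := h (- y); rewrite /ch opprK addrC normrN sqrrN oppr_ge0; exact.
rewrite ger0_norm//; apply: le_trans (expR_ge1Dx _).
set e := expR (y / 2); set f := expR (- (y / 2)).
have ef : e * f = 1 by rewrite -expRD subrr expR0.
have E1 : expR y = e ^+ 2 by rewrite expr2 -expRD -splitr.
have E2 : expR (- y) = f ^+ 2 by rewrite expr2 -expRD -opprD -splitr.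
have e0 : 0 < e by exact: expR_gt0.
have f0 : 0 < f by exact: expR_gt0.
have h : e - f <= y * e.
  have := expR_ge1Dx (- y); rewrite E2.
  have -> : e - f = e * (1 - f ^+ 2) by rewrite mulrBr mulr1 expr2 mulrA ef mul1r.
  by rewrite mulrC => h; rewrite ler_pM2r//; lra.
have h0 : 0 <= e - f by rewrite subr_ge0 ler_expR; lra.
have : (e - f) ^+ 2 <= (y * e) ^+ 2.
  by rewrite lerXn2r// nnegrE mulr_ge0// ltW.
rewrite /ch E1 E2 exprMn; nra.
Qed.

Let ch_iter l k : ch l <= ch (l / 2 ^+ k) ^+ (4 ^ k).
Proof.
elim: k => [|k ih]; first by rewrite expr0 divr1.
apply: le_trans ih _; rewrite expnSr mulnC exprM lerXn2r ?nnegrE ?exprn_ge0//.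
rewrite (_ : l / 2 ^+ k = 2 * (l / 2 ^+ k.+1)) ?ch_double//.
by rewrite exprS; field; rewrite expf_neq0.
Qed.

(* Iterate cosh(2y) <= cosh(y)^4 down to arguments l / 2^k close to 0. *)
Lemma cosh_le_expR (l : R) : (expR l + expR (- l)) / 2 <= expR (l ^+ 2 / 2).
Proof.
rewrite -/(ch l).
have hk k : ch l <= expR (l ^+ 2 / 2 * expR (`|l| / 2 ^+ k)).
  apply: le_trans (ch_iter l k) _.
  apply: le_trans (_ : expR ((l / 2 ^+ k) ^+ 2 / 2 * expR `|l / 2 ^+ k|) ^+ (4 ^ k) <= _).
    by rewrite lerXn2r ?nnegrE ?expR_ge0.
  rewrite -expRM_natl ler_expR normrM normfV normrX (ger0_norm (_ : 0 <= 2))//.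
  rewrite natrX (_ : 4%:R = 2 ^+ 2 :> R); last by rewrite -natrX.
  rewrite le_eqVlt; apply/orP; left; apply/eqP.
  rewrite mulrA; congr (_ * _); rewrite expr_div_n -!exprM mulnC.
  by field; rewrite expf_neq0.
rewrite leNgt; apply/negP => lt.
have c0 : 0 < ch l by apply: le_lt_trans lt; exact: expR_ge0.
have lnlt : l ^+ 2 / 2 < ln (ch l) by rewrite -[ltLHS]expRK ltr_ln ?posrE ?expR_gt0.
have hln k : ln (ch l) <= l ^+ 2 / 2 * expR (`|l| / 2 ^+ k).
  by rewrite -[leRHS]expRK ler_ln ?posrE ?expR_gt0.
have l0 : 0 < l ^+ 2 / 2.
  rewrite lt_neqAle eq_sym divr_ge0 ?sqr_ge0// andbT; apply/negP => /eqP l0.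
  by move: lnlt (hln 0%N); rewrite l0 mul0r => /lt_le_trans h /h; rewrite ltxx.
pose q := ln (ch l) / (l ^+ 2 / 2).
have q1 : 1 < q by rewrite ltr_pdivlMr// mul1r.
have lq : 0 < ln q by rewrite ln_gt0.
have q0 : 0 < q by lra.
(* Since 2^k > k > |l| / ln q, the correction exp(|l| / 2^k) falls below q, contradicting [hln]. *)
pose k := Num.bound (`|l| / ln q).
have kb : `|l| / ln q < k%:R.
  by apply: archi_boundP; rewrite divr_ge0// ltW.
have k2 : k%:R < 2 ^+ k :> R by rewrite -natrX ltr_nat ltn_expl.
have := hln k; rewrite mulrC -ler_pdivrMr// -/q leNgt => /negP; apply.
rewrite -[ltRHS]lnK ?posrE// ltr_expR ltr_pdivrMr ?exprn_gt0//.
have := lt_trans kb k2; rewrite ltr_pdivrMr// mulrC; exact.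
Qed.

Definition sign (b : bool) : R := if b then 1 else -1.

Lemma sign_sqr b : sign b ^+ 2 = 1.
Proof. by case: b; rewrite ?sqrrN expr1n. Qed.

End rademacher.

(** One fair coin is adjoined at a time as a new factor of a product space; [unlift ord0] sends
    index 0 to the new coin and the others to the old signs. *)
Lemma exists_independent_signs (R : realType) (n : nat) :
  exists (d : measure_display) (Om : measurableType d) (P : probability Om R)
    (e : 'I_n -> Om -> R),
  [/\ forall i, measurable_fun setT (e i), independent_family P e,
      forall i w, e i w ^+ 2 = 1 &
      forall i l, (\int[P]_w (expR (l * e i w))%:E <= (expR (l ^+ 2 / 2))%:E)%E].
Proof.
pose B : probability bool R := bernoulli_prob 2^-1.
elim: n => [|n IH].
  exists _, bool, B, (fun _ _ => 1); split; try by case.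
  move=> E mE; rewrite big_ord0 (_ : \bigcap_i _ = setT) ?probability_setT//.
  by apply/seteqP; split=> // w _ [].
have [d [Om [P [e [me inde e2 sge]]]]] := IH.
pose s (i : 'I_n.+1) (w : Om * bool) : R :=
  if unlift ord0 i is Some j then e j w.1 else sign R w.2.
have msign : measurable_fun setT (sign R) by [].
have s0 w : s ord0 w = sign R w.2 by rewrite /s unlift_none.
have sS j w : s (lift ord0 j) w = e j w.1 by rewrite /s liftK.
have ms i : measurable_fun setT (s i).
  case: (unliftP ord0 i) => [j|] ->.
    by apply: (eq_measurable_fun (e j \o fst)) => [w _|]; [rewrite /= sS|exact: measurableT_comp].
  by apply: (eq_measurable_fun (sign R \o snd)) => [w _|];
    [rewrite /= s0|exact: measurableT_comp].
exists _, (Om * bool)%type, (P \x B)%E, s; split => //.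
- move=> E mE; rewrite big_ord_recl.
  have mcap : measurable (\bigcap_(j in setT) (e j @^-1` E (lift ord0 j))).
    apply: fin_bigcap_measurable => // j _.
    by rewrite -[X in measurable X]setTI; exact: me.
  have -> : \bigcap_(i in setT) (s i @^-1` E i) =
      (\bigcap_(j in setT) (e j @^-1` E (lift ord0 j))) `*` (sign R @^-1` E ord0).
    apply/seteqP; split=> [w /= h|w /= [h1 h2] i _].
      split=> [j _|]; first by have /= := h (lift ord0 j) Logic.I; rewrite sS.
      by have /= := h ord0 Logic.I; rewrite s0.
    case: (unliftP ord0 i) => [j|] -> /=; first by rewrite sS; exact: h1.
    by rewrite s0.
  have -> : s ord0 @^-1` E ord0 = setT `*` (sign R @^-1` E ord0).
    by apply/seteqP; split=> w /=; rewrite s0; [split|case].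
  transitivity (P (\bigcap_(j in setT) (e j @^-1` E (lift ord0 j))) * B (sign R @^-1` E ord0))%E.
    exact: product_measure1E.
  rewrite [X in (X * _)%E](inde (fun j => E (lift ord0 j)))// muleC.
  congr (_ * _)%E.
    transitivity (P setT * B (sign R @^-1` E ord0))%E; last exact/esym/product_measure1E.
    by rewrite probability_setT mul1e.
  apply: eq_bigr => j _.
  have -> : s (lift ord0 j) @^-1` E (lift ord0 j) = (e j @^-1` E (lift ord0 j)) `*` setT.
    by apply/seteqP; split=> w /=; rewrite sS; [split|case].
  transitivity (P (e j @^-1` E (lift ord0 j)) * B setT)%E; last first.
    apply/esym/product_measure1E => //.
    by rewrite -[X in measurable X]setTI; exact: me.
  by rewrite probability_setT mule1.
- move=> i w; case: (unliftP ord0 i) => [j|] ->; first by rewrite sS.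
  by rewrite s0 sign_sqr.
move=> i l; rewrite (fubini_tonelli1 (fun w => (expR (l * s i w))%:E))//; last first.
  by apply/measurable_EFinP/measurableT_comp => //; exact: measurable_funM.
rewrite /fubini_F; case: (unliftP ord0 i) => [j|] ->.
  rewrite (eq_integral (fun w => (expR (l * e j w))%:E))// => w _.
  under eq_integral do rewrite sS/=.
  exact: (integral_probability_cst B (expR (l * e j w))%:E).
rewrite (eq_integral (fun=> \int[B]_b (expR (l * sign R b))%:E)%E); last first.
  by move=> w _; apply: eq_integral => b _; rewrite s0.
rewrite (integral_probability_cst P) integral_bernoulli_prob//;
  last by rewrite invr_ge0 ler0n invf_le1//= ler1n.
rewrite -!EFinM -EFinD lee_fin; apply: le_trans (cosh_le_expR l).
by rewrite /sign mulr1 mulrN1 /unstable.onem; lra.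
Qed.

(** * Matrix norms and centred sources *)

Section norms.
Context (R : realType).

(** Minkowski's inequality for squared norms, with a common scale [N]. *)
Lemma sum_sqrD_le (J : finType) (x y : J -> R) (p q N : R) :
  0 <= p -> 0 <= q -> 0 <= N ->
  \sum_r x r ^+ 2 <= p ^+ 2 * N -> \sum_r y r ^+ 2 <= q ^+ 2 * N ->
  \sum_r (x r + y r) ^+ 2 <= (p + q) ^+ 2 * N.
Proof.
move=> p0 q0 N0 xp yq.
have xy : \sum_r x r * y r <= p * q * N.
  apply: le_trans (ler_norm _) _.
  rewrite -(@ler_pXn2r _ 2)// ?nnegrE ?mulr_ge0// real_normK ?num_real//.
  apply: le_trans (sum_mul_sqr_le _ _) _.
  rewrite (_ : _ ^+ 2 = (p ^+ 2 * N) * (q ^+ 2 * N)); last by ring.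
  by apply: ler_pM => //; apply: sumr_ge0 => r _; exact: sqr_ge0.
have -> : \sum_r (x r + y r) ^+ 2 =
    \sum_r x r ^+ 2 + \sum_r y r ^+ 2 + 2 * \sum_r x r * y r.
  by rewrite mulr_sumr -!big_split/=; apply: eq_bigr => r _; ring.
rewrite sqrrD; lra.
Qed.

Lemma fnorm_ge0 m n (A : 'M[R]_(m, n)) : 0 <= fnorm A.
Proof. exact: sqrtr_ge0. Qed.

Context (m n : nat) (A : 'M[R]_(m, n)).

Lemma fnorm_sqr : fnorm A ^+ 2 = \sum_i \sum_j A i j ^+ 2.
Proof.
rewrite sqr_sqrtr//; apply: sumr_ge0 => i _; apply: sumr_ge0 => j _.
exact: sqr_ge0.
Qed.

Lemma fnorm_col_sqr k (v : 'cV[R]_k) : fnorm v ^+ 2 = \sum_i v i 0 ^+ 2.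
Proof.
rewrite sqr_sqrtr; first by apply: eq_bigr => i _; rewrite big_ord1.
by apply: sumr_ge0 => i _; apply: sumr_ge0 => j _; exact: sqr_ge0.
Qed.

(** The supremum defining [opnorm] is meaningful because the Frobenius norm bounds the set, by
    Cauchy-Schwarz. *)
Lemma fnorm_mulmx_le (v : 'cV[R]_n) : fnorm v <= 1 -> fnorm (A *m v) <= opnorm A.
Proof.
move=> v1; apply: ub_le_sup; last by exists v.
exists (fnorm A) => _ [u /= u1 <-].
rewrite -(@ler_pXn2r _ 2)// ?nnegrE ?fnorm_ge0//.
rewrite fnorm_col_sqr fnorm_sqr; apply: ler_sum => i _; rewrite mxE.
apply: le_trans (sum_mul_sqr_le _ _) _.
rewrite -[leRHS]mulr1 ler_wpM2l//; first by apply: sumr_ge0 => j _; exact: sqr_ge0.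
rewrite -fnorm_col_sqr -[leRHS](expr1n _ 2).
by rewrite ler_pXn2r// nnegrE ?fnorm_ge0.
Qed.

Lemma opnorm_ge0 : 0 <= opnorm A.
Proof.
apply: le_trans (fnorm_mulmx_le (v := 0) _); first exact: fnorm_ge0.
rewrite /fnorm big1 ?sqrtr0// => i _; rewrite big1// => j _.
by rewrite mxE expr0n.
Qed.

Lemma sum_mulmx_sqr_le (y : 'I_n -> R) :
  \sum_i (\sum_j A i j * y j) ^+ 2 <= opnorm A ^+ 2 * \sum_j y j ^+ 2.
Proof.
set N := \sum_j y j ^+ 2.
have N0 : 0 <= N by apply: sumr_ge0 => j _; exact: sqr_ge0.
have [Nz|Nz] := eqVneq N 0.
  rewrite big1 ?Nz ?mulr0// => i _; rewrite big1 ?expr0n// => j _.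
  have /psumr_eq0P := Nz => /(_ (fun j _ => sqr_ge0 (y j)) j isT)/eqP.
  by rewrite sqrf_eq0 => /eqP ->; rewrite mulr0.
have Np : 0 < N by rewrite lt_neqAle eq_sym Nz.
pose c := (Num.sqrt N)^-1.
have c2 : c ^+ 2 = N^-1 by rewrite exprVn sqr_sqrtr.
pose v : 'cV[R]_n := \col_j (c * y j).
have v1 : fnorm v <= 1.
  rewrite -(@ler_pXn2r _ 2)// ?nnegrE ?fnorm_ge0// fnorm_col_sqr expr1n.
  under eq_bigr do rewrite mxE exprMn.
  by rewrite -mulr_sumr c2 -/N mulVf.
have := fnorm_mulmx_le v1.
rewrite -(@ler_pXn2r _ 2)// ?nnegrE ?fnorm_ge0 ?opnorm_ge0// fnorm_col_sqr.
have -> : \sum_i (A *m v) i 0 ^+ 2 = N^-1 * \sum_i (\sum_j A i j * y j) ^+ 2.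
  rewrite mulr_sumr; apply: eq_bigr => i _; rewrite mxE -c2 -exprMn mulr_sumr.
  by congr (_ ^+ 2); apply: eq_bigr => j _; rewrite mxE; ring.
by rewrite mulrC ler_pdivrMr.
Qed.

(** The transpose has the same norm bound, by duality: with v = A^T u, |v|^2 is the inner product of
    A v and u. *)
Lemma sum_mulmx_tr_sqr_le (u : 'I_m -> R) :
  \sum_j (\sum_i A i j * u i) ^+ 2 <= opnorm A ^+ 2 * \sum_i u i ^+ 2.
Proof.
pose v j := \sum_i A i j * u i.
have vv : \sum_j v j ^+ 2 = \sum_i (\sum_j A i j * v j) * u i.
  under eq_bigr do rewrite expr2 {2}/v mulr_sumr.
  rewrite exchange_big/=; apply: eq_bigr => i _; rewrite mulr_suml.
  by apply: eq_bigr => j _; ring.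
have h1 : (\sum_j v j ^+ 2) ^+ 2 <= (opnorm A ^+ 2 * \sum_j v j ^+ 2) * \sum_i u i ^+ 2.
  rewrite {1}vv; apply: le_trans (sum_mul_sqr_le _ _) _.
  rewrite ler_wpM2r ?sum_mulmx_sqr_le//.
  by apply: sumr_ge0 => i _; exact: sqr_ge0.
have v0 : 0 <= \sum_j v j ^+ 2 by apply: sumr_ge0 => j _; exact: sqr_ge0.
rewrite -/(v _); have [->|vn0] := eqVneq (\sum_j v j ^+ 2) 0.
  by rewrite mulr_ge0 ?sqr_ge0//; apply: sumr_ge0 => i _; exact: sqr_ge0.
have vp : 0 < \sum_j v j ^+ 2 by rewrite lt_neqAle eq_sym vn0.
by rewrite -(ler_pM2l vp) -expr2 (le_trans h1)// mulrCA mulrA.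
Qed.

End norms.

Section centering.
Context (R : realType) (d : measure_display) (T : measurableType d).
Context (Pr : probability T R) (S : T -> R).
Hypothesis mS : measurable_fun setT S.
Hypothesis sgS : (sg_norm Pr S <= 1)%E.

Let X w := S w - fine ('E_Pr[S])%E.

(** The sub-Gaussian norm is an infimum, so the hypothesis yields admissible t below 1 + e for every
    e > 0 only; the bound at t = 1 is a limit. *)
Lemma sg_norm_le1_expR (l : R) :
  (\int[Pr]_w (expR (l * X w))%:E <= (expR (l ^+ 2 / 2))%:E)%E.
Proof.
have ht (e : R) : 0 < e ->
    (\int[Pr]_w (expR (l * X w))%:E <= (expR (l ^+ 2 * (1 + e) ^+ 2 / 2))%:E)%E.
  move=> e0.
  have : (sg_norm Pr S < (1 + e)%:E)%E.
    by apply: le_lt_trans sgS _; rewrite lte_fin ltrDl.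
  move=> /ereal_inf_lt[_ [t [t0 tS] <-]]; rewrite lte_fin => te.
  have -> : (\int[Pr]_w (expR (l * X w))%:E = 'E_Pr[fun w => expR (l * X w)])%E.
    by rewrite unlock.
  apply: le_trans (tS l) _.
  rewrite lee_fin ler_expR ler_wpM2r// ler_wpM2l ?sqr_ge0//.
  by rewrite lerXn2r ?nnegrE ?ltW//; lra.
have fin : (\int[Pr]_w (expR (l * X w))%:E)%E \is a fin_num.
  rewrite ge0_fin_numE; last by apply: integral_ge0 => w _; rewrite lee_fin expR_ge0.
  exact: le_lt_trans (ht _ ltr01) (ltry _).
rewrite -(fineK fin) lee_fin; set a := fine _.
have ha (e : R) : 0 < e -> a <= expR (l ^+ 2 * (1 + e) ^+ 2 / 2).
  by move=> /ht; rewrite -(fineK fin) lee_fin.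
have [a0|a0] := leP a 0; first exact: le_trans a0 (expR_ge0 _).
rewrite -[a]lnK// ler_expR; apply/ler_addgt0Pl => e e0.
have l2 := sqr_ge0 l.
(* u <= 1 gives (1 + u)^2 <= 1 + 3u, and the second bound keeps the resulting excess of the exponent
   below e. *)
pose u := Num.min 1 (e / (2 * (l ^+ 2 + 1))).
have u0 : 0 < u by rewrite lt_min ltr01/= divr_gt0//; lra.
have u1 : u <= 1 by rewrite ge_min lexx.
have ue : u * (2 * (l ^+ 2 + 1)) <= e.
  by rewrite -ler_pdivlMr; [rewrite ge_min lexx orbT|lra].
have := ha u u0; rewrite -[a in a <= _]lnK// ler_expR => /le_trans; apply.
have : l ^+ 2 * u ^+ 2 <= l ^+ 2 * u by rewrite ler_wpM2l// expr2 ler_piMl// ltW.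
by rewrite sqrrD expr1n mul1r; lra.
Qed.

Lemma measurable_centered : measurable_fun setT X.
Proof. exact: measurable_funB. Qed.

(** The exponential moments of [X] are finite whatever constant was subtracted, so [S] is
    integrable; only then is that constant known to be its mean. *)
Lemma sg_norm_integrable : Pr.-integrable setT (fun w => (S w)%:E).
Proof.
have iX := sg_integrable measurable_centered sg_norm_le1_expR.
apply: (eq_integrable measurableT (fun w => (X w)%:E + (fine ('E_Pr[S])%E)%:E)%E).
  by move=> w _; rewrite -EFinD /X subrK.
by apply: integrableD => //; exact: finite_measure_integrable_cst.
Qed.

Lemma integral_centered : (\int[Pr]_w (X w)%:E = 0)%E.
Proof.
have fE : (\int[Pr]_w (S w)%:E)%E \is a fin_num.
  by apply: integrable_fin_num => //; exact: sg_norm_integrable.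
under eq_integral do rewrite EFinB.
rewrite integralB//; [|exact: sg_norm_integrable|exact: finite_measure_integrable_cst].
by rewrite integral_probability_cst unlock fineK// subee.
Qed.

End centering.

Lemma independent_family_shift (R : realType) (d : measure_display)
    (T : measurableType d) (Pr : probability T R) (n : nat) (S : 'I_n -> T -> R)
    (c : 'I_n -> R) :
  independent_family Pr S -> independent_family Pr (fun i w => S i w - c i).
Proof.
move=> indS E mE.
have h := indS (fun i => (fun x => x - c i) @^-1` E i); rewrite -h// => i.
rewrite -[X in measurable X]setTI.
have m : measurable_fun setT (fun x : R => x - c i) by exact: measurable_funB.
exact: m.
Qed.

Lemma sum_option (R : realType) (K : nat) (F : option 'I_K -> R) :
  \sum_o F o = \sum_k F (Some k) + F None.
Proof.
rewrite (bigD1 None)//= addrC; congr (_ + _).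
rewrite (reindex_omap Some id)//=; last by case.
by apply: eq_bigl => k; rewrite eqxx.
Qed.

Lemma sum_prodE (R : realType) (I J : finType) (F : I * J -> R) :
  \sum_p F p = \sum_i \sum_j F (i, j).
Proof. by rewrite pair_bigA; apply: eq_bigr => -[]. Qed.

(** * The received energy *)

(* The outputs are indexed by r = (m, c), with c telling the real from the
   imaginary part, the summands of an output by [option 'I_K], [None] being the
   noise, and the sources by j, with variance v j. *)
Section random_signs.
Context (R : realType) (K M n : nat).
Context (Z : 'I_M * bool -> option 'I_K -> 'I_n -> R) (v : 'I_n -> R).
Context (op_A op_B fr_A fr_B P Db Dm : R) (a : 'I_K -> R).
Hypotheses (op_A0 : 0 <= op_A) (op_B0 : 0 <= op_B) (fr_A0 : 0 <= fr_A) (fr_B0 : 0 <= fr_B).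
Hypotheses (P0 : 0 < P) (Dm0 : 0 <= Dm) (DmDb : Dm <= Db).
Hypothesis ZA : forall y, \sum_r \sum_k (\sum_j Z r (Some k) j * y j) ^+ 2
  <= op_A ^+ 2 * \sum_j y j ^+ 2.
Hypothesis ZB : forall y, \sum_r (\sum_j Z r None j * y j) ^+ 2 <= op_B ^+ 2 * \sum_j y j ^+ 2.
Hypothesis ZAt : forall r u, \sum_j (\sum_k Z r (Some k) j * u k) ^+ 2
  <= op_A ^+ 2 * \sum_k u k ^+ 2.
Hypothesis ZBt : forall r, \sum_j Z r None j ^+ 2 <= op_B ^+ 2.
Hypothesis ZAF : \sum_r \sum_k \sum_j Z r (Some k) j ^+ 2 <= fr_A ^+ 2.
Hypothesis ZBF : \sum_r \sum_j Z r None j ^+ 2 <= fr_B ^+ 2.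
Hypothesis v01 : forall j, 0 <= v j <= 1.
Hypothesis Zv : forall r k, \sum_j Z r (Some k) j ^+ 2 * v j = 1.
Hypothesis aP : forall k, a k ^+ 2 <= P.
Hypothesis aDb : Dm / P * \sum_k a k ^+ 2 <= Db.

Context (h b q s : R).
Hypotheses (h0 : 0 <= h) (b0 : 0 <= b) (q0 : 0 <= q).
Hypotheses (h2 : h ^+ 2 = 2^-1) (b2 : b ^+ 2 = Db) (q2 : q ^+ 2 = Dm / P).
Hypothesis sE : s = h * q.

Let amp (o : option 'I_K) : R := if o is Some k then a k else 1.
Let s2 : s ^+ 2 = 2^-1 * (Dm / P). Proof. by rewrite sE exprMn h2 q2. Qed.
Let Db0 : 0 <= Db. Proof. exact: le_trans DmDb. Qed.

(** The matrix C_e that maps the sources to the rescaled outputs. As s^2 = Dm/(2P) and each use has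
    two real outputs, user k contributes (Dm/P) a_k^2 to the mean energy per use. *)
Definition received (e : option 'I_K -> 'I_M -> R) (r : 'I_M * bool) (j : 'I_n) : R :=
  s * \sum_o amp o * e o r.1 * Z r o j.

Let L := (b * op_A + q * op_B) ^+ 2.
Let f := (b * fr_A + q * fr_B) ^+ 2.

(** Cauchy-Schwarz over the users costs s^2 times the sum of the a_k^2, at most Db/2; the noise has
    s^2 = q^2/2. Minkowski's inequality combines the two contributions, for the operator and the
    Frobenius norm alike. *)
Lemma received_bounded e : (forall o m, e o m ^+ 2 = 1) ->
  (forall y, qform (received e) y <= L / 2 * \sum_j y j ^+ 2) /\
  \sum_r \sum_j received e r j ^+ 2 <= f / 2.
Proof.
move=> e1.
have sa : s ^+ 2 * \sum_k (a k * 1) ^+ 2 <= h ^+ 2 * Db.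
  under eq_bigr do rewrite mulr1.
  by rewrite s2 h2 -mulrA ler_wpM2l.
have CS r (z : 'I_K -> R) : (s * \sum_k a k * e (Some k) r * z k) ^+ 2 <=
    h ^+ 2 * Db * \sum_k z k ^+ 2.
  rewrite exprMn; apply: le_trans (_ : s ^+ 2 * ((\sum_k a k ^+ 2) * \sum_k z k ^+ 2) <= _).
    rewrite ler_wpM2l ?sqr_ge0//; apply: le_trans (sum_mul_sqr_le _ _) _.
    by under eq_bigr do rewrite exprMn e1 mulr1.
  rewrite mulrA ler_wpM2r//; first by apply: sumr_ge0 => k _; exact: sqr_ge0.
  by rewrite s2 h2 -mulrA ler_wpM2l.
have N0 (y : 'I_n -> R) : 0 <= \sum_j y j ^+ 2 by apply: sumr_ge0 => j _; exact: sqr_ge0.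
have CSN r z : (s * (e None r * z)) ^+ 2 = (h * q) ^+ 2 * z ^+ 2.
  by rewrite sE !exprMn e1 mul1r.
have L2 : L / 2 = (h * b * op_A + h * q * op_B) ^+ 2.
  rewrite /L mulrC -h2 -exprMn; congr (_ ^+ 2); ring.
have f2 : f / 2 = (h * b * fr_A + h * q * fr_B) ^+ 2.
  rewrite /f mulrC -h2 -exprMn; congr (_ ^+ 2); ring.
have hD t : (h * b * t) ^+ 2 = h ^+ 2 * Db * t ^+ 2.
  by rewrite !exprMn b2.
have hDb0 : 0 <= h ^+ 2 * Db by rewrite mulr_ge0 ?sqr_ge0.
have rE r j : received e r j =
    s * \sum_k a k * e (Some k) r.1 * Z r (Some k) j + s * (e None r.1 * Z r None j).
  by rewrite /received sum_option/= mul1r mulrDr.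
split.
  move=> y.
  have split r : \sum_j received e r j * y j =
      s * \sum_k a k * e (Some k) r.1 * (\sum_j Z r (Some k) j * y j) +
      s * (e None r.1 * \sum_j Z r None j * y j).
    under eq_bigr do rewrite rE mulrDl.
    rewrite big_split/=; congr (_ + _).
      under [in RHS]eq_bigr do rewrite mulr_sumr.
      rewrite exchange_big/= mulr_sumr; apply: eq_bigr => j _.
      rewrite -mulrA mulr_suml; congr (_ * _).
      by apply: eq_bigr => k _; rewrite mulrA.
    by rewrite !mulr_sumr; apply: eq_bigr => j _; ring.
  rewrite /qform; under eq_bigr do rewrite split.
  rewrite L2; apply: sum_sqrD_le.
  - by rewrite !mulr_ge0.
  - by rewrite !mulr_ge0.
  - exact: N0.
  - apply: le_trans (_ : \sum_r h ^+ 2 * Db * \sum_k (\sum_j Z r (Some k) j * y j) ^+ 2 <= _).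
      by apply: ler_sum => r _; exact: CS.
    by rewrite -mulr_sumr hD -[leRHS]mulrA ler_wpM2l.
  - under eq_bigr do rewrite CSN.
    by rewrite -mulr_sumr [in leRHS]exprMn -[leRHS]mulrA ler_wpM2l ?sqr_ge0.
rewrite f2 pair_big/=; under eq_bigr do rewrite rE.
rewrite -[leRHS]mulr1.
apply: (@sum_sqrD_le _ _ (fun p => s * \sum_k a k * e (Some k) p.1.1 * Z p.1 (Some k) p.2)
   (fun p => s * (e None p.1.1 * Z p.1 None p.2))) => //.
- by rewrite !mulr_ge0.
- by rewrite !mulr_ge0.
- apply: le_trans (_ : \sum_(p : ('I_M * bool) * 'I_n) h ^+ 2 * Db * \sum_k Z p.1
    (Some k) p.2 ^+ 2 <= _).
    by apply: ler_sum => p _; exact: CS.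
  rewrite -mulr_sumr hD mulr1 ler_wpM2l//.
  rewrite sum_prodE/=.
  by under eq_bigr do rewrite exchange_big/=.
under eq_bigr do rewrite CSN.
rewrite -mulr_sumr mulr1 [in leRHS]exprMn ler_wpM2l ?sqr_ge0//.
by rewrite sum_prodE/=.
Qed.

Let N := #|{: option 'I_K * 'I_M}|.

(* Given the signs e, [received_mean] expresses the conditional mean of the energy
   as the sum of the squares of these linear forms in e. *)
Definition sign_form (rj : ('I_M * bool) * 'I_n) (p : 'I_N) : R :=
  if (enum_val p).2 == rj.1.1
  then Num.sqrt (v rj.2) * s * amp (enum_val p).1 * Z rj.1 (enum_val p).1 rj.2
  else 0.

Let sum_pairs (F : 'I_N -> R) :
  \sum_p F p = \sum_o \sum_m F (enum_rank (o, m)).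
Proof.
rewrite (reindex enum_rank)/=; last exact/onW_bij/enum_rank_bij.
by rewrite pair_big; apply: eq_bigr => -[].
Qed.

Let sum_sign_form (F : R -> 'I_N -> R) rj : (forall p, F 0 p = 0) ->
  \sum_p F (sign_form rj p) p =
  \sum_o F (Num.sqrt (v rj.2) * s * amp o * Z rj.1 o rj.2) (enum_rank (o, rj.1.1)).
Proof.
move=> F0; rewrite sum_pairs; apply: eq_bigr => o _.
rewrite (bigD1 rj.1.1)//= big1 ?addr0; first by rewrite /sign_form enum_rankK eqxx.
by move=> m /negbTE mr; rewrite /sign_form enum_rankK/= mr.
Qed.

Let v0 j : 0 <= v j. Proof. by have /andP[] := v01 j. Qed.
Let v1 j : v j <= 1. Proof. by have /andP[] := v01 j. Qed.

Let sum_rows (F : ('I_M * bool) -> R) : (forall r, F r = F (r.1, true)) ->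
  \sum_r F r = 2 * \sum_m F (m, true).
Proof.
move=> Fr; rewrite sum_prodE mulr_sumr.
apply: eq_bigr => m _; rewrite big_bool/= (Fr (m, false))/=; ring.
Qed.

(** Within each output row the signs enter through a transposed row block, bounded by [ZAt] and
    [ZBt]. Each use has two rows, which cancels the one half in s^2: 2 s^2 P = Dm <= Db for the
    fading and 2 s^2 = q^2 for the noise. *)
Lemma sign_form_sum_le u :
  qform sign_form u <= L * \sum_p u p ^+ 2.
Proof.
have U0 : 0 <= \sum_p u p ^+ 2 by apply: sumr_ge0 => p _; exact: sqr_ge0.
have UE : \sum_p u p ^+ 2 = \sum_m \sum_k u (enum_rank (Some k, m)) ^+ 2 +
    \sum_m u (enum_rank (None, m)) ^+ 2.
  by rewrite sum_pairs sum_option exchange_big.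
have UA0 : 0 <= \sum_m \sum_k u (enum_rank (Some k, m)) ^+ 2.
  by apply: sumr_ge0 => m _; apply: sumr_ge0 => k _; exact: sqr_ge0.
have UB0 : 0 <= \sum_m u (enum_rank (None, m)) ^+ 2.
  by apply: sumr_ge0 => m _; exact: sqr_ge0.
pose xA (rj : ('I_M * bool) * 'I_n) :=
  s * \sum_k Z rj.1 (Some k) rj.2 * (a k * u (enum_rank (Some k, rj.1.1))).
pose xB (rj : ('I_M * bool) * 'I_n) := s * (Z rj.1 None rj.2 * u (enum_rank (None, rj.1.1))).
apply: (@le_trans _ _ (\sum_rj (xA rj + xB rj) ^+ 2)).
  apply: ler_sum => rj _.
  rewrite (sum_sign_form (F := fun t p => t * u p)); last by move=> p; rewrite mul0r.
  have -> : \sum_o Num.sqrt (v rj.2) * s * amp o * Z rj.1 o rj.2 * u (enum_rank (o, rj.1.1)) =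
      Num.sqrt (v rj.2) * (xA rj + xB rj).
    rewrite sum_option/= mulrDr /xA /xB; congr (_ + _); last by ring.
    by rewrite !mulr_sumr; apply: eq_bigr => k _; ring.
  by rewrite exprMn sqr_sqrtr// ler_piMl ?sqr_ge0.
apply: sum_sqrD_le => //; rewrite ?mulr_ge0//.
- rewrite sum_prodE/=.
  apply: le_trans (_ : \sum_(r : 'I_M * bool) s ^+ 2 * op_A ^+ 2 * P * \sum_k u (enum_rank
    (Some k, r.1)) ^+ 2 <= _).
    apply: ler_sum => r _; rewrite /xA/=; under eq_bigr do rewrite exprMn.
    rewrite -mulr_sumr -2![leRHS]mulrA ler_wpM2l ?sqr_ge0//;
      apply: le_trans (ZAt r (fun k => a k * u (enum_rank (Some k, r.1)))) _.
    rewrite ler_wpM2l ?sqr_ge0// mulr_sumr; apply: ler_sum => k _.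
    by rewrite exprMn ler_wpM2r ?sqr_ge0.
  rewrite sum_rows// -mulr_sumr/= [in leRHS]exprMn b2 UE.
  set UA := \sum_m \sum_k _ in UA0 *; set UB := \sum_m _ in UB0 *.
  rewrite s2.
  have -> : 2 * (2^-1 * (Dm / P) * op_A ^+ 2 * P * UA) = Dm * (op_A ^+ 2 * UA).
    by field; rewrite gt_eqF.
  rewrite -[leRHS]mulrA; apply: ler_pM => //; first by rewrite mulr_ge0 ?sqr_ge0.
  by rewrite ler_wpM2l ?sqr_ge0// lerDl.
rewrite sum_prodE/=.
apply: le_trans (_ : \sum_(r : 'I_M * bool) s ^+ 2 * op_B ^+ 2 * u (enum_rank
  (None, r.1)) ^+ 2 <= _).
  apply: ler_sum => r _; rewrite /xB/=.
  under eq_bigr do rewrite exprMn exprMn.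
  by rewrite -mulr_sumr -mulr_suml -mulrA ler_wpM2l ?sqr_ge0// ler_wpM2r ?sqr_ge0.
rewrite sum_rows// -mulr_sumr/= [in leRHS]exprMn q2 UE.
set UA := \sum_m \sum_k _ in UA0 *; set UB := \sum_m _ in UB0 *.
rewrite s2.
have -> : 2 * (2^-1 * (Dm / P) * op_B ^+ 2 * UB) = Dm / P * op_B ^+ 2 * UB.
  by field; rewrite gt_eqF.
by rewrite ler_wpM2l ?lerDr// mulr_ge0 ?sqr_ge0// divr_ge0// ltW.
Qed.

(** Unit fading variance makes user k contribute a_k^2 to each of the 2M real outputs; the second
    sum is the energy of the noise. *)
Definition mean_energy : R :=
  s ^+ 2 * (2 * M%:R * \sum_k a k ^+ 2 + \sum_r \sum_j Z r None j ^+ 2 * v j).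

Lemma sign_form_mean : \sum_rj \sum_p sign_form rj p ^+ 2 = mean_energy.
Proof.
rewrite sum_prodE/=.
have E r j : \sum_p sign_form (r, j) p ^+ 2 =
    s ^+ 2 * (\sum_k a k ^+ 2 * (Z r (Some k) j ^+ 2 * v j) + Z r None j ^+ 2 * v j).
  rewrite (sum_sign_form (F := fun t _ => t ^+ 2)); last by move=> p; rewrite expr0n.
  rewrite sum_option/= mulrDr mulr_sumr; congr (_ + _).
    by apply: eq_bigr => k _; rewrite !exprMn sqr_sqrtr//; ring.
  by rewrite !exprMn sqr_sqrtr//; ring.
under eq_bigr => r _ do under eq_bigr => j _ do rewrite E.
under eq_bigr => r _.
  rewrite -mulr_sumr big_split/= exchange_big/=.
  under eq_bigr => k _ do rewrite -mulr_sumr Zv mulr1.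
  over.
rewrite -mulr_sumr big_split/= sumr_const card_prod card_ord card_bool.
have -> : (\sum_k a k ^+ 2) *+ (M * 2) = 2 * M%:R * \sum_k a k ^+ 2.
  by rewrite -[LHS]mulr_natl natrM (mulrC M%:R).
by [].
Qed.

(** From s^2 P = Dm/2 <= Db/2 and s^2 = q^2/2 the sum is at most (b^2 fr_A^2 + q^2 fr_B^2)/2, and
    the square in [f] only adds a nonnegative cross term. *)
Lemma sign_form_fr : \sum_rj \sum_p sign_form rj p ^+ 2 <= f / 2.
Proof.
rewrite sum_prodE/=.
apply: le_trans (_ : \sum_r \sum_j s ^+ 2 * (P * (\sum_k Z r (Some k) j ^+ 2)
  + Z r None j ^+ 2) <= _).
  apply: ler_sum => r _; apply: ler_sum => j _.
  rewrite (sum_sign_form (F := fun t _ => t ^+ 2)); last by move=> p; rewrite expr0n.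
  rewrite sum_option/= mulrDr mulr_sumr mulr_sumr; apply: lerD.
    apply: ler_sum => k _; rewrite !exprMn sqr_sqrtr//.
    apply: (@le_trans _ _ (v j * (s ^+ 2 * (a k ^+ 2 * Z r (Some k) j ^+ 2)))).
      by rewrite !mulrA.
    apply: le_trans (ler_piMl _ (v1 j)) _.
      by apply: mulr_ge0; rewrite ?sqr_ge0// mulr_ge0 ?sqr_ge0.
    by rewrite ler_wpM2l ?sqr_ge0// ler_wpM2r ?sqr_ge0.
  rewrite !exprMn sqr_sqrtr// expr1n mulr1 -mulrA ler_piMl//.
  by rewrite mulr_ge0 ?sqr_ge0.
under eq_bigr do rewrite -mulr_sumr big_split/= -mulr_sumr exchange_big/=.
rewrite -mulr_sumr big_split/= -mulr_sumr.
apply: le_trans (_ : s ^+ 2 * (P * fr_A ^+ 2 + fr_B ^+ 2) <= _).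
  by rewrite ler_wpM2l ?sqr_ge0// lerD// ler_wpM2l// ltW.
have -> : s ^+ 2 * (P * fr_A ^+ 2 + fr_B ^+ 2) = (Dm * fr_A ^+ 2 + q ^+ 2 * fr_B ^+ 2) / 2.
  by rewrite s2 q2; field; rewrite gt_eqF.
rewrite ler_wpM2r// /f sqrrD !exprMn b2.
apply: lerD => //; rewrite -[leLHS]addr0; apply: lerD.
  by rewrite ler_wpM2r ?sqr_ge0.
by rewrite mulrn_wge0// !mulr_ge0.
Qed.

(** The conditional mean is a sum of squares of linear forms in the signs. Since signs square to
    one, its diagonal part is the constant [mean_energy]. *)
Lemma received_mean (e : 'I_N -> R) : (forall p, e p ^+ 2 = 1) ->
  \sum_j gram (received (fun o m => e (enum_rank (o, m)))) j j * v j =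
  mean_energy + offdiag sign_form e.
Proof.
move=> e1.
have -> : mean_energy = \sum_p gram sign_form p p * e p ^+ 2.
  by under eq_bigr do rewrite e1 mulr1; rewrite sum_gram_diag sign_form_mean.
rewrite -qform_diag_off /qform.
rewrite sum_prodE/=.
rewrite exchange_big/=; apply: eq_bigr => j _.
rewrite /gram mulr_suml; apply: eq_bigr => r _.
rewrite (sum_sign_form (F := fun t p => t * e p)); last by move=> p; rewrite mul0r.
rewrite -expr2 -[v j in LHS](sqr_sqrtr (v0 j)) -exprMn; congr (_ ^+ 2).
rewrite /received mulrC mulrA mulr_sumr; apply: eq_bigr => o _ /=; ring.
Qed.

End random_signs.

(** * Concentration of the received energy *)

Section energy_concentration.
Context (R : realType) (K M n : nat).
Context (d : measure_display) (T : measurableType d) (Pr : probability T R).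
Context (X : 'I_n -> T -> R).
Hypothesis mX : forall i, measurable_fun setT (X i).
Hypothesis indX : independent_family Pr X.
Hypothesis sgX : forall i (l : R),
  (\int[Pr]_w (expR (l * X i w))%:E <= (expR (l ^+ 2 / 2))%:E)%E.
Let N := #|{: option 'I_K * 'I_M}|.
Context (dO : measure_display) (Om : measurableType dO) (PO : probability Om R).
Context (e : 'I_N -> Om -> R).
Hypothesis me : forall p, measurable_fun setT (e p).
Hypothesis inde : independent_family PO e.
Hypothesis e1 : forall p u, e p u ^+ 2 = 1.
Hypothesis sge : forall p (l : R),
  (\int[PO]_u (expR (l * e p u))%:E <= (expR (l ^+ 2 / 2))%:E)%E.

Let v j := second_moment Pr (X j).
Context (Z : 'I_M * bool -> option 'I_K -> 'I_n -> R).
Context (op_A op_B fr_A fr_B P Db Dm : R) (a : 'I_K -> R).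
Hypotheses (op_A0 : 0 <= op_A) (op_B0 : 0 <= op_B) (fr_A0 : 0 <= fr_A) (fr_B0 : 0 <= fr_B).
Hypotheses (P0 : 0 < P) (Dm0 : 0 <= Dm) (DmDb : Dm <= Db).
Hypothesis ZA : forall y, \sum_r \sum_k (\sum_j Z r (Some k) j * y j) ^+ 2
  <= op_A ^+ 2 * \sum_j y j ^+ 2.
Hypothesis ZB : forall y, \sum_r (\sum_j Z r None j * y j) ^+ 2 <= op_B ^+ 2 * \sum_j y j ^+ 2.
Hypothesis ZAt : forall r u, \sum_j (\sum_k Z r (Some k) j * u k) ^+ 2
  <= op_A ^+ 2 * \sum_k u k ^+ 2.
Hypothesis ZBt : forall r, \sum_j Z r None j ^+ 2 <= op_B ^+ 2.
Hypothesis ZAF : \sum_r \sum_k \sum_j Z r (Some k) j ^+ 2 <= fr_A ^+ 2.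
Hypothesis ZBF : \sum_r \sum_j Z r None j ^+ 2 <= fr_B ^+ 2.
Hypothesis Zv : forall r k, \sum_j Z r (Some k) j ^+ 2 * v j = 1.
Hypothesis aP : forall k, a k ^+ 2 <= P.
Hypothesis aDb : Dm / P * \sum_k a k ^+ 2 <= Db.
Context (h b q s : R).
Hypotheses (h0 : 0 <= h) (b0 : 0 <= b) (q0 : 0 <= q).
Hypotheses (h2 : h ^+ 2 = 2^-1) (b2 : b ^+ 2 = Db) (q2 : q ^+ 2 = Dm / P).
Hypothesis sE : s = h * q.
Let L := (b * op_A + q * op_B) ^+ 2.
Let f := (b * fr_A + q * fr_B) ^+ 2.

Let v01 j : 0 <= v j <= 1.
Proof. by rewrite second_moment_ge0 second_moment_le1. Qed.

(** For fixed signs the fluctuation around the conditional mean obeys the centred bound with kappa =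
    L/2 and tau = f/2, and 160/4 = 40. The deviation of the conditional mean remains as the second
    factor. *)
Lemma integral_expR_energy_le (l : R) (u : Om) : 16 * (`|l| * L) <= 1 ->
  (\int[Pr]_w (expR (l * (qform (received Z a s (fun o m => e (enum_rank (o, m)) u)) (X ^~ w)
     - mean_energy Z v a s)))%:E
   <= (expR (40 * l ^+ 2 * L * f) * expR (l * offdiag (sign_form Z v a s) (e ^~ u)))%:E)%E.
Proof.
move=> lL; set C := received _ _ _ _.
have L0 : 0 <= L by exact: sqr_ge0.
have Cb := received_bounded op_A0 op_B0 fr_A0 fr_B0 Dm0 DmDb ZA ZB ZAF ZBF aDb h0 b0 q0 h2 b2 q2
  sE
  (e := fun o m => e (enum_rank (o, m)) u) (fun o m => e1 (enum_rank (o, m)) u).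
have mE := received_mean a v01 Zv s (fun p => e1 p u).
rewrite -/C in mE.
have E w : expR (l * (qform C (X ^~ w) - mean_energy Z v a s)) =
    expR (l * offdiag (sign_form Z v a s) (e ^~ u)) *
    expR (l * (qform C (X ^~ w) - \sum_j gram C j j * second_moment Pr (X j))).
  rewrite -expRD -mulrDr; congr (expR (l * _)).
  by rewrite mE; ring.
under eq_integral do rewrite E EFinM.
rewrite ge0_integralZl//; last first.
  apply/measurable_EFinP/measurableT_comp => //; apply: measurable_funM => //.
  by apply: measurable_funB => //; exact: measurable_qform.
rewrite [X in (_ <= X)%E]EFinM muleC lee_wpmul2r ?lee_fin ?expR_ge0//.
have -> : 40 * l ^+ 2 * L * f = 160 * l ^+ 2 * (L / 2) * (f / 2) by field.
apply: (integral_expR_centered_qform_le mX indX sgX) => //; first by rewrite divr_ge0.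
by move: lL; lra.
Qed.

(** The off-diagonal bound for the signs, with kappa = L and tau = f/2; the constant is 64/7 <=
    10. *)
Lemma integral_expR_sign_chaos_le (l : R) : 16 * (`|l| * L) <= 1 ->
  (\int[PO]_u (expR (l * offdiag (sign_form Z v a s) (e ^~ u)))%:E
   <= (expR (10 * l ^+ 2 * L * f))%:E)%E.
Proof.
move=> lL; have L0 : 0 <= L by exact: sqr_ge0.
have f0 : 0 <= f by exact: sqr_ge0.
have Sb := sign_form_sum_le op_A0 op_B0 P0 Dm0 DmDb ZAt ZBt v01 aP b0 q0 h2 b2 q2 sE.
have Sf := sign_form_fr fr_A0 fr_B0 P0 DmDb ZAF ZBF v01 aP b0 q0 h2 b2 q2 sE.
apply: le_trans (integral_expR_offdiag_le me inde sge L0 (conj Sb Sf) lL) _.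
rewrite lee_fin ler_expR -/L -/f.
have : 0 <= l ^+ 2 * L * f by rewrite mulr_ge0// mulr_ge0// sqr_ge0.
by lra.
Qed.

End energy_concentration.

(** * The channel *)

Section injective_sums.
Context (R : realType) (I J : finType) (g : I -> J).
Hypothesis inj_g : injective g.

Lemma sum_inj_le (F : J -> R) : (forall j, 0 <= F j) ->
  \sum_i F (g i) <= \sum_j F j.
Proof.
move=> F0; rewrite -(big_imset F (A := predT))/=; last by move=> i j _ _; exact: inj_g.
rewrite big_mkcond/=; apply: ler_sum => j _.
by case: ifP.
Qed.

(** [w] extends [u] by zero along the injection [g]; the fibre sum avoids a partial inverse. *)
Lemma sum_extend (u : I -> R) : exists2 w : J -> R,
  (forall F : J -> R, \sum_j F j * w j = \sum_i F (g i) * u i) &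
  \sum_j w j ^+ 2 = \sum_i u i ^+ 2.
Proof.
pose w j := \sum_(i | g i == j) u i.
have H (F : J -> R) : \sum_j F j * w j = \sum_i F (g i) * u i.
  rewrite (partition_big g predT)//=; apply: eq_bigr => j _.
  by rewrite /w mulr_sumr; apply: eq_bigr => i /eqP ->.
exists w => //; under eq_bigr do rewrite expr2.
rewrite H; apply: eq_bigr => i _; rewrite /w expr2; congr (_ * _).
by apply: big_pred1 => i' /=; rewrite (inj_eq inj_g).
Qed.

End injective_sums.

Section complex_random_variables.
Context (R : realType) (d : measure_display) (T : measurableType d).

Lemma measurable_re_im (c : bool) : measurable_fun setT (@re_im R c).
Proof.
have mp : measurable_fun setT (@complex_pair R).
  by move=> _ B mB; rewrite setTI; exists B => //; rewrite setTI.
by case: c; [exact: (measurableT_comp measurable_snd mp)|exact: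
  (measurableT_comp measurable_fst mp)].
Qed.

Lemma measurable_real_complex (f : T -> R) :
  measurable_fun setT f -> measurable_fun setT (fun x => (f x)%:C%C).
Proof.
move=> mf _ A [B mB <-]; rewrite !setTI.
have mg : measurable_fun setT (fun x => (f x, 0 : R)) by exact: measurable_fun_pair.
by have := mg measurableT B mB; rewrite setTI.
Qed.

End complex_random_variables.

Section stacked_indices.
Context (K M : nat).

Fact fading_index_subproof (r : 'I_M * bool) (k : 'I_K) :
  ((2 * r.1 + r.2) * K + k < 2 * K * M)%N.
Proof. by case: r k => -[m hm] c [k hk]/=; case: c => /=; nia. Qed.

Fact noise_index_subproof (r : 'I_M * bool) : (2 * r.1 + r.2 < 2 * M)%N.
Proof. by case: r => -[m hm] c/=; case: c => /=; lia. Qed.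

(** The position in the stacked vector of part c of H_k(m), for r = (m, c); it inverts [user_of],
    [use_of] and the parity test of [fading_vec]. *)
Definition fading_index r k : 'I_(2 * K * M) := Ordinal (fading_index_subproof r k).
Definition noise_index r : 'I_(2 * M) := Ordinal (noise_index_subproof r).

Lemma fading_index_block r k : (fading_index r k %/ K = 2 * r.1 + r.2)%N.
Proof. by rewrite /= divnMDl ?divn_small ?addn0//; case: k => k /=; lia. Qed.

Lemma user_of_fading_index r k : user_of (fading_index r k) = k.
Proof. by apply/val_inj; rewrite /= modnMDl modn_small. Qed.

Lemma half_block (m : nat) (c : bool) : ((2 * m + c)./2 = m)%N.
Proof. by case: c; lia. Qed.

Lemma odd_block (m : nat) (c : bool) : odd (2 * m + c) = c.
Proof. by rewrite oddD mul2n odd_double; case: c. Qed.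

Lemma use_of_fading_index r k : use_of (fading_index r k) = r.1.
Proof.
apply/val_inj; rewrite -[RHS](half_block _ r.2).
by congr (_./2); exact: fading_index_block.
Qed.

Lemma noise_use_of_noise_index r : noise_use_of (noise_index r) = r.1.
Proof. by apply/val_inj; rewrite /= half_block. Qed.

Lemma noise_index_inj : injective noise_index.
Proof.
move=> [m c] [m' c'] h; have e := congr1 val h; rewrite /= in e.
have <- : c = c' by rewrite -(odd_block m c) e odd_block.
congr pair; apply/val_inj => /=.
by rewrite -(half_block m c) e half_block.
Qed.

Lemma fading_index_inj : injective (fun p => fading_index p.1 p.2).
Proof.
move=> [r k] [r' k'] /= h.
have <- : k = k' by rewrite -(user_of_fading_index r k) h user_of_fading_index.
congr pair; apply: noise_index_inj; apply/val_inj => /=.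
by rewrite -(fading_index_block r k) h fading_index_block.
Qed.

End stacked_indices.

Lemma integral_linear (R : realType) (d : measure_display) (T : measurableType d)
    (Pr : probability T R) (n : nat) (X : 'I_n -> T -> R) (c : 'I_n -> R) :
  (forall j, Pr.-integrable setT (fun w => (X j w)%:E)) ->
  (forall j, (\int[Pr]_w (X j w)%:E = 0)%E) ->
  Pr.-integrable setT (fun w => (\sum_j c j * X j w)%:E) /\
  (\int[Pr]_w (\sum_j c j * X j w)%:E = 0)%E.
Proof.
move=> iX X0; elim: (index_enum _) => [|j l [ih1 ih2]].
  under eq_fun do rewrite big_nil.
  split; [exact: finite_measure_integrable_cst|exact: integral_probability_cst].
have icX : Pr.-integrable setT (fun w => ((c j)%:E * (X j w)%:E)%E) by exact: integrableZl.
split.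
  apply: (eq_integrable measurableT (fun w => (c j)%:E * (X j w)%:E +
    (\sum_(i <- l) c i * X i w)%:E)%E).
    by move=> w _; rewrite big_cons EFinD EFinM.
  exact: integrableD.
under eq_integral do rewrite big_cons EFinD EFinM.
by rewrite integralD// ih2 integralZl// X0 mule0 adde0.
Qed.

Section channel.
Context (R : realType) (K M : nat) (d : measure_display) (T : measurableType d).
Context (Pr : probability T R).
Context (A : 'M[R]_(2 * K * M, 2 * K * M + 2 * M)) (B : 'M[R]_(2 * M, 2 * K * M + 2 * M)).
Context (H : 'I_K -> 'I_M -> {RV Pr >-> R[i]}) (N : 'I_M -> {RV Pr >-> R[i]}).
Hypothesis HN : correlated_channel A B H N.

(** The given sources may have nonzero means, but fading and noise are centred, so subtracting the
    means does not change them. The last clause expresses unit fading variance through the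
    sources. *)
Lemma centered_sources : exists X : 'I_(2 * K * M + 2 * M) -> T -> R,
  [/\ forall j, measurable_fun setT (X j),
      independent_family Pr X,
      forall j (l : R), (\int[Pr]_w (expR (l * X j w))%:E <= (expR (l ^+ 2 / 2))%:E)%E &
      [/\ forall r k w, re_im r.2 (H k r.1 w) = \sum_j A (fading_index r k) j * X j w,
          forall r w, re_im r.2 (N r.1 w) = \sum_j B (noise_index r) j * X j w &
          forall (r : 'I_M * bool) (k : 'I_K),
            \sum_j A (fading_index r k) j ^+ 2 * second_moment Pr (X j) = 1]].
Proof.
have [S [indS sgS HS NS]] := correlated_by HN.
have mS j : measurable_fun setT (S j) by [].
pose mu j := fine ('E_Pr[S j])%E.
pose X j w := S j w - mu j.
have mX j : measurable_fun setT (X j) by exact: measurable_centered.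
have sgX j (l : R) : (\int[Pr]_w (expR (l * X j w))%:E <= (expR (l ^+ 2 / 2))%:E)%E.
  exact: sg_norm_le1_expR.
have indX : independent_family Pr X by exact: independent_family_shift.
have X0 j : (\int[Pr]_w (X j w)%:E = 0)%E by exact: integral_centered.
have iX j : Pr.-integrable setT (fun w => (X j w)%:E) by exact: sg_integrable.
(* A row applied to the means of the sources is the mean of the corresponding output coordinate,
   hence zero. *)
have centered (c : 'I_(2 * K * M + 2 * M) -> R) (Y : T -> R) :
    (forall w, Y w = \sum_j c j * S j w) -> ('E_Pr[Y] = 0)%E ->
    forall w, Y w = \sum_j c j * X j w.
  move=> YS; rewrite unlock => EY w.
  have YX w' : Y w' = \sum_j c j * X j w' + \sum_j c j * mu j.
    by rewrite YS -big_split/=; apply: eq_bigr => j _; rewrite -mulrDr subrK.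
  have [i1 i2] := integral_linear c iX X0.
  suff : \sum_j c j * mu j = 0 by rewrite YX => ->; rewrite addr0.
  move: EY; under eq_integral do rewrite YX EFinD.
  rewrite integralD//; last exact: finite_measure_integrable_cst.
  by rewrite i2 add0e integral_probability_cst => -[].
have HX r k w : re_im r.2 (H k r.1 w) = \sum_j A (fading_index r k) j * X j w.
  apply: (centered (A (fading_index r k)) (re_im r.2 \o H k r.1)).
    move=> w' /=; have := congr1 (fun V : 'cV[R]_(2 * K * M) => V (fading_index r k) 0) (HS w').
    rewrite !mxE user_of_fading_index use_of_fading_index fading_index_block odd_block => -> .
    by apply: eq_bigr => j _; rewrite mxE.
  exact: (fading_mean HN).
exists X; split => //; split => //.
- move=> r w.
  apply: (centered (B (noise_index r)) (re_im r.2 \o N r.1)).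
    move=> w' /=; have := congr1 (fun V : 'cV[R]_(2 * M) => V (noise_index r) 0) (NS w').
    rewrite !mxE noise_use_of_noise_index odd_block => -> .
    by apply: eq_bigr => j _; rewrite mxE.
  exact: (noise_mean HN).
move=> r k; apply: EFin_inj.
rewrite -(integral_linear_sqr mX indX sgX X0) -(fading_variance HN k r.1 r.2).
rewrite /variance covariance.unlock (fading_mean HN) expectation.unlock;
  apply: eq_integral => w _.
transitivity ((re_im r.2 (H k r.1 w) - 0) * (re_im r.2 (H k r.1 w) - 0))%:E => //.
by rewrite subr0 -expr2 HX.
Qed.

End channel.

(** * Norm bounds for the stacked channel matrices *)

Section stacked_matrix.
Context (R : realType) (K M n : nat).
Context (A : 'M[R]_(2 * K * M, n)) (B : 'M[R]_(2 * M, n)).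

Definition stacked (r : 'I_M * bool) (o : option 'I_K) (j : 'I_n) : R :=
  if o is Some k then A (fading_index r k) j else B (noise_index r) j.

Lemma stacked_fading_le y :
  \sum_r \sum_k (\sum_j stacked r (Some k) j * y j) ^+ 2 <= opnorm A ^+ 2 * \sum_j y j ^+ 2.
Proof.
apply: le_trans (sum_mulmx_sqr_le A y); rewrite pair_bigA/=.
apply: (sum_inj_le (@fading_index_inj K M) (F := fun i => (\sum_j A i j * y j) ^+ 2)) => i.
exact: sqr_ge0.
Qed.

Lemma stacked_noise_le y :
  \sum_r (\sum_j stacked r None j * y j) ^+ 2 <= opnorm B ^+ 2 * \sum_j y j ^+ 2.
Proof.
apply: le_trans (sum_mulmx_sqr_le B y).
apply: (sum_inj_le (@noise_index_inj M) (F := fun i => (\sum_j B i j * y j) ^+ 2)) => i.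
exact: sqr_ge0.
Qed.

(** Extending [u] by zero to all rows turns the single block into the transpose of [A]. *)
Lemma stacked_fading_tr_le r u :
  \sum_j (\sum_k stacked r (Some k) j * u k) ^+ 2 <= opnorm A ^+ 2 * \sum_k u k ^+ 2.
Proof.
have inj : injective (fading_index r : 'I_K -> 'I_(2 * K * M)).
  by move=> k k' kk'; have [] := @fading_index_inj K M (r, k) (r, k') kk'.
have [w wE <-] := sum_extend inj u.
under eq_bigr => j _ do rewrite -(wE (A ^~ j)).
exact: sum_mulmx_tr_sqr_le.
Qed.

Lemma stacked_noise_tr_le r : \sum_j stacked r None j ^+ 2 <= opnorm B ^+ 2.
Proof.
pose u (i : 'I_(2 * M)) : R := (i == noise_index r)%:R.
have sum_u (F : 'I_(2 * M) -> R) : \sum_i F i * u i = F (noise_index r).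
  rewrite (bigD1 (noise_index r))//= /u eqxx mulr1 big1 ?addr0// => i /negbTE ir.
  by rewrite ir mulr0.
have := sum_mulmx_tr_sqr_le B u.
under [X in _ <= _ * X -> _]eq_bigr do rewrite expr2.
by rewrite sum_u /u eqxx mulr1; under eq_bigr do rewrite sum_u.
Qed.

Lemma stacked_fading_fr :
  \sum_r \sum_k \sum_j stacked r (Some k) j ^+ 2 <= fnorm A ^+ 2.
Proof.
rewrite fnorm_sqr pair_bigA/=.
apply: (sum_inj_le (@fading_index_inj K M) (F := fun i => \sum_j A i j ^+ 2)) => i.
by apply: sumr_ge0 => j _; exact: sqr_ge0.
Qed.

Lemma stacked_noise_fr : \sum_r \sum_j stacked r None j ^+ 2 <= fnorm B ^+ 2.
Proof.
rewrite fnorm_sqr.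
apply: (sum_inj_le (@noise_index_inj M) (F := fun i => \sum_j B i j ^+ 2)) => i.
by apply: sumr_ge0 => j _; exact: sqr_ge0.
Qed.

End stacked_matrix.

(** * Tail bounds and order of integration *)

Lemma measurable_ge_norm (R : realType) (d : measure_display)
    (T : measurableType d) (g : T -> R) (t : R) :
  measurable_fun setT g -> measurable [set w | t <= `|g w|].
Proof.
move=> mg.
rewrite (_ : mkset _ = [set: T] `&` (fun w => `|g w|) @^-1` `[t, +oo[%classic).
  by apply: (measurableT_comp (@normr_measurable R setT) mg).
by rewrite setTI; apply/seteqP; split=> w /=; rewrite in_itv/= andbT.
Qed.

(** On the event, one of exp(l g) and exp(-l g) is at least exp(l t), so their sum times exp(-l t)
    dominates the indicator. *)
Lemma chernoff_two_sided (R : realType) (d : measure_display) (T : measurableType d)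
    (mu : {measure set T -> \bar R}) (g : T -> R) (l t c : R) :
  measurable_fun setT g -> 0 <= l ->
  (\int[mu]_w (expR (l * g w))%:E <= c%:E)%E ->
  (\int[mu]_w (expR (- l * g w))%:E <= c%:E)%E ->
  (mu [set w | t <= `|g w|]%R <= (2 * (c * expR (- (l * t))))%:E)%E.
Proof.
move=> mg l0 c1 c2; set E := [set w | _].
have mE : measurable E by exact: measurable_ge_norm.
have ml (l' : R) : measurable_fun setT (fun w => (expR (l' * g w))%:E).
  by apply/measurable_EFinP/measurableT_comp => //; exact: measurable_funM.
set k := expR (- (l * t)).
have -> : (mu E = \int[mu]_w (\1_E w)%:E)%E by rewrite integral_indic// setIT.
apply: (@le_trans _ _ (\int[mu]_w (k%:E * (expR (l * g w))%:E + k%:E * (expR (- l * g w))%:E))%E).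
  apply: ge0_le_integral => //.
  - by apply/measurable_EFinP; exact: measurable_indic.
  - by apply: emeasurable_funD; exact: measurable_funeM.
  move=> w _; rewrite -!EFinM -EFinD lee_fin indicE.
  have [/set_mem Ew'|_] := boolP (w \in E); last by rewrite addr_ge0// mulr_ge0// expR_ge0.
  have Ew : t <= `|g w| by exact: Ew'.
  rewrite -!expRD; case: (ger0P (g w)) Ew => g0 Ew.
    rewrite -[leLHS]addr0 lerD ?expR_ge0// -expR0 ler_expR addrC subr_ge0.
    by rewrite ler_wpM2l.
  rewrite -[leLHS]add0r lerD ?expR_ge0// -expR0 ler_expR addrC subr_ge0 mulNr -mulrN.
  by rewrite ler_wpM2l.
have k0 : 0 <= k := expR_ge0 _.
rewrite ge0_integralD//; last 4 first.
- by move=> w _; rewrite mule_ge0// lee_fin expR_ge0.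
- exact: measurable_funeM.
- by move=> w _; rewrite mule_ge0// lee_fin expR_ge0.
- exact: measurable_funeM.
rewrite !ge0_integralZl//.
have -> : 2 * (c * k) = k * c + k * c by ring.
by rewrite EFinD !EFinM leeD// lee_wpmul2l// lee_fin expR_ge0.
Qed.

Section iterated_integrals.
Context (R : realType) (d1 d2 : measure_display).
Context (T1 : measurableType d1) (T2 : measurableType d2).
Context (m1 : {sigma_finite_measure set T1 -> \bar R}).
Context (m2 : {sigma_finite_measure set T2 -> \bar R}).
Context (G : T1 * T2 -> R).
Hypothesis mG : measurable_fun setT G.
Hypothesis G0 : forall w, 0 <= G w.
Local Open Scope ereal_scope.

Let mGE : measurable_fun setT (fun w => (G w)%:E).
Proof. exact/measurable_EFinP. Qed.

Let GE0 w : 0 <= (G w)%:E.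
Proof. by rewrite lee_fin. Qed.

Lemma integral_prod_le1 (h : T1 -> \bar R) :
  measurable_fun setT h ->
  (forall x, \int[m2]_y (G (x, y))%:E <= h x) ->
  \int[m1 \x m2]_w (G w)%:E <= \int[m1]_x h x.
Proof.
move=> mh Gh.
rewrite (_ : integral _ _ _ = \int[m1]_x \int[m2]_y (G (x, y))%:E); last first.
  exact: (fubini_tonelli1 _ mGE GE0).
apply: ge0_le_integral => //.
- by move=> x _; exact: integral_ge0.
- exact: (measurable_fun_fubini_tonelli_F _ mGE GE0).
Qed.

Lemma integral_prod_le2 (h : T2 -> \bar R) :
  measurable_fun setT h ->
  (forall y, \int[m1]_x (G (x, y))%:E <= h y) ->
  \int[m1 \x m2]_w (G w)%:E <= \int[m2]_y h y.
Proof.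
move=> mh Gh.
rewrite (_ : integral _ _ _ = \int[m2]_y \int[m1]_x (G (x, y))%:E); last first.
  exact: (fubini_tonelli2 _ mGE GE0).
apply: ge0_le_integral => //.
- by move=> x _; exact: integral_ge0.
- exact: (measurable_fun_fubini_tonelli_G _ mGE GE0).
Qed.

End iterated_integrals.

(** Integrate over the channel with data and signs fixed, then over the signs with data fixed. The
    bound is then uniform in the data and survives integration against any data law. *)
Lemma integral_triple_le (R : realType) (d d' d'' : measure_display)
    (T : measurableType d) (W : measurableType d') (Om : measurableType d'')
    (Pr : probability T R) (Q : probability W R) (PO : probability Om R)
    (G : T * (W * Om) -> R) (h : W * Om -> R) (c : R) :
  measurable_fun setT G -> (forall w, 0 <= G w) ->
  measurable_fun setT h -> (forall w, 0 <= h w) ->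
  (forall p, \int[Pr]_t (G (t, p))%:E <= (h p)%:E)%E ->
  (forall w, \int[PO]_u (h (w, u))%:E <= c%:E)%E ->
  (\int[Pr \x (Q \x PO)]_w (G w)%:E <= c%:E)%E.
Proof.
move=> mG G0 mh h0 Gh hc.
pose QPO : probability (W * Om)%type R := (Q \x PO)%E.
apply: (@le_trans _ _ (\int[QPO]_p (h p)%:E)%E).
  have := @integral_prod_le2 R _ _ T (W * Om)%type Pr QPO G mG G0 (fun p => (h p)%:E).
  by apply => //; exact/measurable_EFinP.
apply: (@le_trans _ _ (\int[Q]_w c%:E)%E).
  exact: (@integral_prod_le1 R _ _ W Om Q PO h mh h0 (fun=> c%:E)).
by rewrite integral_probability_cst.
Qed.

(** This [l] makes the linear term exactly 2t. The part 256 F of the bound on m keeps the quadratic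
    term below 200t/256 <= t, and the part 32 eps L gives the constraint on l L. *)
Lemma chernoff_parameter (R : realType) (t eps m L F : R) :
  0 < t -> 0 < eps -> 0 < m -> 0 <= L -> 0 <= F ->
  t / eps ^+ 2 * (256 * F + 32 * eps * L) <= m ->
  let l := 2 * t / (m * eps) in
  [/\ 0 <= l, 16 * (l * L) <= 1 & 50 * l ^+ 2 * (F * m) - l * (m * eps) <= - t].
Proof.
move=> t0 e0 m0 L0 F0 hm l.
have e2 : 0 < eps ^+ 2 by rewrite exprn_gt0.
have me : 0 < m * eps by rewrite mulr_gt0.
have me2 : 0 < m * eps ^+ 2 by rewrite mulr_gt0.
have hm2 : t * (256 * F + 32 * eps * L) <= m * eps ^+ 2.
  by rewrite -ler_pdivrMr// mulrAC.
have F1 : 256 * (t * F) <= m * eps ^+ 2.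
  by have := mulr_ge0 (mulr_ge0 (ltW e0) (ltW t0)) L0; lra.
have L1 : 32 * (t * L) <= m * eps.
  by rewrite -(ler_pM2r e0); have := mulr_ge0 (ltW t0) F0; lra.
split.
- by apply: divr_ge0; [rewrite mulr_ge0 ?(ltW t0)|exact: ltW].
- rewrite (_ : 16 * (l * L) = 32 * (t * L) / (m * eps)); last by rewrite /l; ring.
  by rewrite ler_pdivrMr// mul1r.
have -> : l * (m * eps) = 2 * t by rewrite /l divfK// gt_eqF.
have -> : 50 * l ^+ 2 * (F * m) = 200 * t * (t * F / (m * eps ^+ 2)).
  by rewrite /l; field; rewrite !gt_eqF.
have h : t * F / (m * eps ^+ 2) <= 256^-1.
  by rewrite ler_pdivrMr// [leRHS]mulrC ler_pdivlMr// mulrC.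
by have := ler_wpM2l (ltW t0) h; lra.
Qed.

Section re_im.
Context (R : realType) (c : bool).
Implicit Types z : R[i].

Lemma re_im_sum (I : Type) (r : seq I) (F : I -> R[i]) :
  re_im c (\sum_(i <- r) F i) = \sum_(i <- r) re_im c (F i).
Proof.
apply: (big_morph (re_im c)); last by case: c.
by case: c => -[? ?] [? ?].
Qed.

Lemma re_imD z z' : re_im c (z + z') = re_im c z + re_im c z'.
Proof. by case: c; case: z; case: z'. Qed.

Lemma re_imM_real z (r : R) : re_im c (z * r%:C%C) = re_im c z * r.
Proof. by case: c; case: z => x y /=; rewrite mulr0 ?subr0 ?add0r. Qed.

End re_im.

(* The loss is not assumed measurable in x, so the error event is measured by the
   outer measure [mu_ext], which equals the probability on measurable events. *)
Theorem corollary5 (R : realType) (K M : nat) (hK : (0 < K)%N) (hM : (0 < M)%N)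
    (P : R) (hP : 0 < P)
    (dX : 'I_K -> measure_display) (X : forall k, measurableType (dX k))
    (g : forall k, X k -> R)
    (g_meas : forall k, measurable_fun setT (g k))
    (g_label : forall k x, labels (g k x))
    (alpha : 'I_K -> R) (alpha_ge0 : forall k, 0 <= alpha k)
    (Loss : (forall k, X k) -> R -> R -> R)
    (Lambda : R) (hLambda : 0 < Lambda)
    (Loss_ge0 : forall x y t, labels y -> 0 <= Loss x y t)
    (Loss_lip : forall x y, labels y -> Lambda.-lipschitz (Loss x y))
    (d : measure_display) (T : measurableType d) (Pr : probability T R)
    (H : 'I_K -> 'I_M -> {RV Pr >-> R[i]}) (N : 'I_M -> {RV Pr >-> R[i]})
    (A Ai : 'M[R]_(2 * K * M, 2 * K * M + 2 * M))
    (B : 'M[R]_(2 * M, 2 * K * M + 2 * M))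
    (hHN : correlated_channel A B H N)
    (hAi : user_uncorrelated Ai)
    (eta : R) (heta : opnorm ((A + Ai) *m (A - Ai)^T) <= eta)
    (eps : R) (heps : 0 < eps) (delta : R) (hdelta : 0 < delta < 1)
    (hMbound :
      let Db := total_spread alpha in
      let Dm := max_spread alpha in
      let L := (Num.sqrt Db * opnorm A + Num.sqrt (Dm / P) * opnorm B) ^+ 2 in
      let F := L * (Num.sqrt (Db / M%:R) * fnorm A
                    + Num.sqrt (Dm / (P * M%:R)) * fnorm B) ^+ 2 in
      let D := (4 * Num.sqrt (2 * M%:R) * Db * eta
                + 4 * (Dm / Num.sqrt (P * M%:R)) * fnorm (A *m B^T)) ^+ 2 in
      (ln 4 - ln delta) / eps ^+ 2
        * Num.max (16 * F + D + 4 * eps * L) (256 * F + 32 * eps * L)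
      <= M%:R) :
  exists S : dfa_scheme M X P,
    forall (dW : measure_display) (W : measurableType dW) (Q : probability W R)
      (x : forall k, {RV Q >-> X k}) (y : R), labels y ->
    (mu_ext (Pr \x (Q \x rnd_law S))
       [set w : T * (W * rnd_space S) |
          let xK := fun k => x k w.2.1 in
          (Lambda * eps <=
           `|Loss xK y (dfa_estimate (fun k m => H k m w.1) (fun m => N m w.1)
                          xK w.2.2)
             - Loss xK y (ensemble alpha g xK)|)%R]
     <= delta%:E)%E.
Proof.
have [V [mV indV sgV [HV NV Zv]]] := centered_sources hHN.
have [dO [Om [PO [e [me inde e1 sge]]]]] :=
  exists_independent_signs R #|{: option 'I_K * 'I_M}|.
set Db := total_spread alpha in hMbound; set Dm := max_spread alpha in hMbound.
move: hMbound => /=; set L := (_ + _) ^+ 2; set F := L * _ => hMbound.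
have Dm_ge k : 2 * alpha k <= Dm.
  rewrite /Dm /max_spread ler_pM2l//; exact: le_bigmax.
have Dm0 : 0 <= Dm by apply: le_trans (Dm_ge (Ordinal hK)); rewrite mulr_ge0.
have DmDb : Dm <= Db.
  rewrite /Dm /Db ler_pM2l//; apply: bigmax_le => [|k _]; first exact: sumr_ge0.
  by rewrite (bigD1 k)//= lerDl sumr_ge0.
have Db0 : 0 <= Db by exact: le_trans DmDb.
(* s^2 = Dm/(2P) normalises the energy: P cancels against the transmit power, and the one half
   accounts for two real outputs per use. *)
pose q := Num.sqrt (Dm / P); pose b := Num.sqrt Db.
pose h : R := Num.sqrt 2^-1; pose s := h * q.
have q0 : 0 <= q by exact: sqrtr_ge0.
have b0 : 0 <= b by exact: sqrtr_ge0.
have h0 : 0 <= h by exact: sqrtr_ge0.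
have q2 : q ^+ 2 = Dm / P by rewrite sqr_sqrtr// divr_ge0// ltW.
have b2 : b ^+ 2 = Db by rewrite sqr_sqrtr.
have h2 : h ^+ 2 = 2^-1 by rewrite sqr_sqrtr.
have s2 : s ^+ 2 = 2^-1 * (Dm / P) by rewrite exprMn h2 q2.
pose Z := stacked A B.
pose v j := second_moment Pr (V j).
(* Mean energy of the noise, a constant of the channel law that the decoder subtracts. *)
pose eN := \sum_r \sum_j Z r None j ^+ 2 * v j.
(* Adding 1 to g_k makes the quantity encoded in the power nonnegative; it is at most Dm, which
   yields the power bound P. *)
pose amp k (xk : X k) := Num.sqrt (P / Dm * (alpha k * (g k xk + 1))).
have g01 k xk : 0 <= g k xk + 1 <= 2 by case: (g_label k xk) => ->; apply/andP; lra.
have ag k xk : 0 <= alpha k * (g k xk + 1) <= Dm.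
  have /andP[g0 g2] := g01 k xk; rewrite mulr_ge0//=; apply: le_trans (Dm_ge k).
  by rewrite mulrC ler_wpM2r.
(* When Dm = 0, also P / Dm = 0, but then all the weights vanish. *)
have PD0 : 0 <= P / Dm by rewrite divr_ge0// ltW.
have amp2 k xk : amp k xk ^+ 2 = P / Dm * (alpha k * (g k xk + 1)).
  by rewrite sqr_sqrtr// mulr_ge0//; case/andP: (ag k xk).
have ampD k xk : Dm / P * amp k xk ^+ 2 = alpha k * (g k xk + 1).
  rewrite amp2; have [Dz|Dnz] := eqVneq Dm 0; last by field; rewrite Dnz gt_eqF.
  by have := ag k xk; rewrite Dz => /le_anti <-; rewrite !mulr0.
have ampP k xk : amp k xk ^+ 2 <= P.
  rewrite amp2; have [->|Dnz] := eqVneq Dm 0; first by rewrite invr0 mulr0 mul0r ltW.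
  rewrite -mulrA -[leRHS]mulr1 ler_pM2l// mulrC ler_pdivrMr ?mul1r.
    by case/andP: (ag k xk).
  by rewrite lt_neqAle eq_sym Dnz.
have mamp k : measurable_fun setT (amp k).
  apply: (measurableT_comp (continuous_measurable_fun (@sqrt_continuous R))).
  by apply: measurable_funM => //; apply: measurable_funM => //; exact: measurable_funD.
(* The transmitted sign is the user's own sign times the shared sign, which is stored at index
   [None]. *)
pose rnd k m : {RV PO >-> R} := mfun_Sub (mem_set
  (measurable_funM (me (enum_rank (Some k, m))) (me (enum_rank (None, m))))).
pose encode k (m : 'I_M) (xk : X k) (r : R) : R[i] := (amp k xk * r)%:C%C.
pose energy (y : M.-tuple R[i]) := \sum_(r : 'I_M * bool) re_im r.2 (tnth y r.1) ^+ 2.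
(* Inverts the affine relation between mean energy and ensemble; the last sum undoes the shift of
   g_k by 1. *)
pose decode y := (s ^+ 2 * energy y - s ^+ 2 * eN) / M%:R - \sum_k alpha k.
have menc k : measurable_fun setT (fun p : X k * M.-tuple R =>
    [tuple encode k m p.1 (tnth p.2 m) | m < M]).
  apply/measurable_fun_tnthP => m.
  apply: (@eq_measurable_fun _ _ _ _ _ (fun p : X k * M.-tuple R => encode k m p.1 (tnth p.2 m))).
    by move=> p _; rewrite /= tnth_mktuple.
  apply: measurable_real_complex; apply: measurable_funM.
    by apply: measurableT_comp.
  by apply: (measurableT_comp (measurable_tnth m)).
have mdec : measurable_fun setT decode.
  apply: measurable_funB => //; apply: measurable_funM => //; apply: measurable_funB => //.
  apply: measurable_funM => //; apply: measurable_sum => r; apply: measurable_funX.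
  exact: (measurableT_comp (measurable_re_im r.2) (measurable_tnth r.1)).
have pow k m (xk : X k) u : `|encode k m xk (rnd k m u)| ^+ 2 <= P%:C%C.
  rewrite normc_def /= expr0n addr0 sqrtr_sqr -rmorphXn lecR real_normK ?num_real//.
  by rewrite !exprMn !e1 !mulr1.
exists (@DfaScheme R K M dX X P dO Om PO _ R rnd encode decode menc mdec pow).
move=> dW W Q x y hy.
pose am (w : W) k := amp k (x k w).
pose C w u := received Z (am w) s (fun o m => e (enum_rank (o, m)) u).
pose Zt (p : T * (W * Om)) :=
  qform (C p.2.1 p.2.2) (V ^~ p.1) - mean_energy Z v (am p.2.1) s.
have M0 : 0 < M%:R :> R by rewrite ltr0n.
(* Multiplying the output of use m by e_0(m) does not change its energy. *)
have energyE (t : T) (w : W) (u : Om) :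
    s ^+ 2 * energy (channel_output (fun k m => H k m t)
      (fun k m => encode k m (x k w) (rnd k m u)) (fun m => N m t)) =
    qform (C w u) (V ^~ t).
  rewrite /energy mulr_sumr; apply: eq_bigr => r _.
  set e0 := e (enum_rank (None, r.1)) u.
  have -> : \sum_j C w u r j * V j t =
      s * (e0 * re_im r.2 (tnth (channel_output (fun k m => H k m t)
      (fun k m => encode k m (x k w) (rnd k m u)) (fun m => N m t)) r.1)).
    rewrite tnth_mktuple re_imD re_im_sum NV.
    under [X in _ = s * (e0 * (X + _))]eq_bigr do rewrite /encode re_imM_real HV.
    under [LHS]eq_bigr do rewrite /C /received -mulrA mulr_suml.
    rewrite -mulr_sumr exchange_big/= sum_option/=; congr (_ * _).
    rewrite mulrDr mulr_sumr; congr (_ + _); last first.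
      by rewrite mulr_sumr; apply: eq_bigr => j _; rewrite mul1r mulrA.
    apply: eq_bigr => k _; rewrite mulr_suml mulr_sumr; apply: eq_bigr => j _.
    rewrite -/e0; have := e1 (enum_rank (None, r.1)) u; rewrite -/e0 expr2 => e00.
    transitivity (e0 * (Z r (Some k) j * V j t *
      (amp k (x k w) * (e (enum_rank (Some k, r.1)) u * e0)))) => //.
    rewrite [RHS](_ : _ = e0 * e0 * (am w k * e (enum_rank (Some k, r.1)) u *
      Z r (Some k) j * V j t)); last by rewrite /am; ring.
    by rewrite e00 mul1r.
  by rewrite !exprMn e1 mul1r.
(* The estimation error is exactly the centred energy divided by M. *)
have estE (p : T * (W * Om)) :
    decode (channel_output (fun k m => H k m p.1)
      (fun k m => encode k m (x k p.2.1) (rnd k m p.2.2)) (fun m => N m p.1)) -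
    ensemble alpha g (fun k => x k p.2.1) = Zt p / M%:R.
  rewrite /decode energyE /Zt /mean_energy -/eN mulrDr.
  have -> : s ^+ 2 * (2 * M%:R * \sum_k am p.2.1 k ^+ 2) =
      M%:R * (\sum_k alpha k + ensemble alpha g (fun k => x k p.2.1)).
    rewrite (_ : s ^+ 2 * (2 * M%:R * _) = M%:R * (Dm / P * \sum_k am p.2.1 k ^+ 2)); last first.
      by rewrite s2; field; rewrite gt_eqF.
    rewrite mulr_sumr; congr (_ * _); rewrite -big_split/=; apply: eq_bigr => k _.
    by rewrite ampD mulrDr mulr1 addrC.
  by field; rewrite gt_eqF.
have mam k : measurable_fun setT (fun p : T * (W * Om) => am p.2.1 k).
  apply: (measurableT_comp (mamp k)); apply: (measurableT_comp (measurable_funPT (x k))).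
  exact: (measurableT_comp measurable_fst measurable_snd).
have me2 o : measurable_fun setT (fun p : T * (W * Om) => e o p.2.2).
  apply: (measurableT_comp (me o)); exact: (measurableT_comp measurable_snd measurable_snd).
have mV1 j : measurable_fun setT (fun p : T * (W * Om) => V j p.1).
  exact: (measurableT_comp (mV j) measurable_fst).
have mZt : measurable_fun setT Zt.
  apply: measurable_funB.
    apply: measurable_sum => r; apply: measurable_funX; apply: measurable_sum => j.
    apply: measurable_funM => //; apply: measurable_funM => //.
    apply: measurable_sum => o; apply: measurable_funM => //.
    by apply: measurable_funM => //; case: o.
  apply: measurable_funM => //; apply: measurable_funD => //; apply: measurable_funM => //.
  by apply: measurable_sum => k; exact: measurable_funX.
pose QPO : probability (W * Om)%type R := (Q \x PO)%E.
pose mu : {measure set (T * (W * Om)) -> \bar R} := (Pr \x QPO)%E.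
(* Lipschitz continuity places the error event inside a measurable deviation event, to which the
   outer measure is then compared. *)
have bad p : Lambda * eps <= `|Loss (fun k => x k p.2.1) y
    (decode (channel_output (fun k m => H k m p.1)
      (fun k m => encode k m (x k p.2.1) (rnd k m p.2.2)) (fun m => N m p.1)))
    - Loss (fun k => x k p.2.1) y (ensemble alpha g (fun k => x k p.2.1))| ->
    M%:R * eps <= `|Zt p|.
  move=> /le_trans/(_ (Loss_lip (fun k => x k p.2.1) y hy (_, _) (conj I I))) /=.
  rewrite estE ler_pM2l// normrM normfV (ger0_norm (ltW M0)).
  by rewrite ler_pdivlMr// mulrC.
set E := [set p | _].
have mE : measurable [set p | M%:R * eps <= `|Zt p|] by exact: measurable_ge_norm.
have sub : E `<=` [set p | M%:R * eps <= `|Zt p|] by move=> p; exact: bad.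
apply: (@le_trans _ _ (mu [set p | M%:R * eps <= `|Zt p|])).
  rewrite -(measurable_mu_extE mu mE).
  exact: le_mu_ext.
pose f := (b * fnorm A + q * fnorm B) ^+ 2.
pose l := 2 * (ln 4 - ln delta) / (M%:R * eps).
have L0 : 0 <= L by exact: sqr_ge0.
have f0 : 0 <= f by exact: sqr_ge0.
(* Both square roots in F contain 1/M; its root is a common factor of the bracket. *)
have Ff : F = L * f / M%:R.
  rewrite /F -mulrA; congr (_ * _).
  pose r := Num.sqrt (M%:R^-1 : R).
  have r2 : r ^+ 2 = M%:R^-1 by rewrite sqr_sqrtr// invr_ge0 ltW.
  rewrite [RHS](_ : _ = ((b * fnorm A + q * fnorm B) * r) ^+ 2); last by rewrite exprMn r2.
  congr (_ ^+ 2).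
  have -> : Dm / (P * M%:R) = Dm / P / M%:R by rewrite invfM mulrA.
  have DP0 : 0 <= Dm / P by rewrite divr_ge0// ltW.
  by rewrite (sqrtrM _ Db0) (sqrtrM _ DP0) -/r -/b -/q; ring.
have lpos : 0 <= l /\ 16 * (l * L) <= 1 /\ 50 * l ^+ 2 * L * f - l * (M%:R * eps)
  <= ln delta - ln 4.
  have [d0 d1] := andP hdelta.
  have t0 : 0 < ln 4 - ln delta.
    by rewrite subr_gt0 ltr_ln ?posrE//; apply: lt_trans d1 _; rewrite ltr1n.
  have F0 : 0 <= F by rewrite Ff; apply: divr_ge0; [exact: mulr_ge0|exact: ltW].
  have Me : 0 < M%:R * eps by rewrite mulr_gt0.
  set t := ln 4 - ln delta in hMbound t0 l *.
  have hM2 : t / eps ^+ 2 * (256 * F + 32 * eps * L) <= M%:R.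
    apply: le_trans hMbound; rewrite ler_wpM2l ?divr_ge0 ?sqr_ge0 ?(ltW t0)//.
    by rewrite le_max lexx orbT.
  have [-> lL lF] := chernoff_parameter t0 heps M0 L0 F0 hM2.
  have -> : ln delta - ln 4 = - t by rewrite opprB.
  split => //; split => //; apply: le_trans lF.
  have -> : F * M%:R = L * f by rewrite Ff divfK// gt_eqF.
  by rewrite (mulrA (50 * l ^+ 2) L f).
have [l0 [lL lf]] := lpos.
have am2 w k : am w k ^+ 2 <= P by exact: ampP.
have amD w : Dm / P * \sum_k am w k ^+ 2 <= Db.
  rewrite mulr_sumr /Db /total_spread mulr_sumr; apply: ler_sum => k _.
  rewrite ampD mulrC ler_wpM2r//; by case/andP: (g01 k (x k w)).
(* Bound on the exponential moment over the channel, given data and signs. *)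
pose chaos l' (p : W * Om) := expR (40 * l' ^+ 2 * L * f) *
  expR (l' * offdiag (sign_form Z v (am p.1) s) (e ^~ p.2)).
have mchaos l' : measurable_fun setT (chaos l').
  have mamW k : measurable_fun setT (fun p : W * Om => am p.1 k).
    apply: (measurableT_comp (mamp k)).
    exact: (measurableT_comp (measurable_funPT (x k)) measurable_fst).
  have meW o : measurable_fun setT (fun p : W * Om => e o p.2).
    exact: (measurableT_comp (me o) measurable_snd).
  have mS r o : measurable_fun setT (fun p : W * Om => sign_form Z v (am p.1) s r o).
    rewrite /sign_form; case: (_ == _) => //.
    apply: measurable_funM => //; apply: measurable_funM => //.
    by case: (enum_val o).1.
  apply: measurable_funM => //; apply: measurableT_comp => //; apply: measurable_funM => //.
  apply: measurable_sum => i; under eq_fun do rewrite big_mkcond/=.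
  apply: measurable_sum => j; case: (_ != _) => //.
  apply: measurable_funM; last exact: measurable_funM.
  by apply: measurable_sum => r; exact: measurable_funM.
(* 50 = 40 + 10: the channel fluctuation for fixed signs plus that of the signs. *)
have mgf l' : 16 * (`|l'| * L) <= 1 ->
    (\int[mu]_p (expR (l' * Zt p))%:E <= (expR (50 * l' ^+ 2 * L * f))%:E)%E.
  move=> hl'.
  apply: (@integral_triple_le R _ _ _ T W Om Pr Q PO (fun p => expR (l' * Zt p)) (chaos l')).
  - by apply: measurableT_comp => //; exact: measurable_funM.
  - by move=> p; exact: expR_ge0.
  - exact: mchaos.
  - by move=> p; rewrite mulr_ge0 ?expR_ge0.
  - move=> p; exact: (integral_expR_energy_le mV indV sgV e1
      (opnorm_ge0 A) (opnorm_ge0 B) (fnorm_ge0 A) (fnorm_ge0 B) Dm0 DmDb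
      (stacked_fading_le A B) (stacked_noise_le A B) (stacked_fading_fr A B)
        (stacked_noise_fr A B)
      Zv (amD p.1) h0 b0 q0 h2 b2 q2 erefl p.2 hl').
  move=> w; under eq_integral do rewrite EFinM.
  rewrite ge0_integralZl//; last first.
    apply/measurable_EFinP/measurableT_comp => //; apply: measurable_funM => //.
    by rewrite /=; exact: measurable_offdiag.
  rewrite (_ : 50 * l' ^+ 2 * L * f = 40 * l' ^+ 2 * L * f + 10 * l' ^+ 2 * L * f); last by ring.
  rewrite expRD EFinM lee_wpmul2l ?lee_fin ?expR_ge0//.
  rewrite /=; exact: (integral_expR_sign_chaos_le mV sgV me inde sge
    (opnorm_ge0 A) (opnorm_ge0 B) (fnorm_ge0 A) (fnorm_ge0 B) hP Dm0 DmDb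
    (stacked_fading_tr_le A B) (stacked_noise_tr_le A B)
    (stacked_fading_fr A B) (stacked_noise_fr A B) (am2 w) b0 q0 h2 b2 q2 erefl hl').
apply: le_trans (chernoff_two_sided (M%:R * eps) mZt l0 (mgf _ _) _) _.
- by rewrite ger0_norm.
- by rewrite -(sqrrN l); apply: mgf; rewrite normrN ger0_norm.
rewrite lee_fin -expRD.
(* Each of the two tails contributes delta/4, so the total is delta/2. *)
apply: le_trans (_ : 2 * expR (ln delta - ln 4) <= _).
  by rewrite ler_pM2l// ler_expR; lra.
move: hdelta => /andP[d0 d1].
rewrite expRB !lnK ?posrE//.
lra.
Qed.
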